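(* Let $A$, $S(0)$ be $n\times n$ matrices and $\Pi(0)=\begin{bmatrix}\vartheta_1&\vartheta_2\end{bmatrix}$ an $n\times m$ matrix (with $\vartheta_i$ of size $n\times m_i$) such that $S(0)>0$, $\det A\ne0$ and $$AS(0)-S(0)A^*=\mathrm{i}\,\Pi(0)\,j\,\Pi(0)^*.$$ Introduce, for $x\ge0$, the matrix functions $$\Pi(x)=\begin{bmatrix}\mathrm{e}^{-\mathrm{i}xA}\vartheta_1&\mathrm{e}^{\mathrm{i}xA}\vartheta_2\end{bmatrix},\qquad S(x)=S(0)+\int_0^x\Pi(\xi)\Pi(\xi)^*\,d\xi,$$ $$u(x)=\big(I_m-\mathrm{i}j\Pi(x)^*S(x)^{-1}A^{-1}\Pi(x)\big)\big(I_m+\mathrm{i}j\Pi(0)^*(A^{-1})^*S(0)^{-1}\Pi(0)\big),$$ and $$Y(x,t)=u(x)^*j\Pi(x)^*S(x)^{-1}\mathrm{e}^{\mathrm{i}tA}.$$ Then $$Y(x,t)=\left(j\,w_A(0,0)\begin{bmatrix} I_{m_1}+\mathrm{i}\vartheta_1^*(A^{-1})^*\varkappa_Q\vartheta_1&0\\0&I_{m_2}-\mathrm{i}\vartheta_2^*(A^{-1})^*\varkappa_R\vartheta_2\end{bmatrix}+o(1)\right)\begin{bmatrix}\big(\vartheta_1^*\varkappa_Q+o(1)\big)\mathrm{e}^{\mathrm{i}(t+x)A}\\ \big(\vartheta_2^*\varkappa_R+o(1)\big)\mathrm{e}^{\mathrm{i}(t-x)A}\end{bmatrix},$$ where the $o(1)$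 terms are matrix functions of $x$ (of appropriate sizes) which tend to $0$ when $x$ tends to infinity.
   Context: All matrices are complex; $n\in\mathbb N$; $m_1>0$, $m_2>0$, $m=m_1+m_2$; $I_p$ is the $p\times p$ identity matrix; $j=\begin{bmatrix} I_{m_1}&0\\0&-I_{m_2}\end{bmatrix}$. $M^*$ is the conjugate transpose of $M$, and $M>0$ means $M$ is Hermitian positive definite. Since $S(0)>0$, the matrices $S(x)$, $x\ge0$, are positive definite, hence invertible. The matrix function $w_A$ is $$w_A(x,\lambda):=I_m-\mathrm{i}j\Pi(x)^*S(x)^{-1}(A-\lambda I_n)^{-1}\Pi(x),$$ so that $w_A(0,0)=I_m-\mathrm{i}j\Pi(0)^*S(0)^{-1}A^{-1}\Pi(0)$. Put $$Q(x)=\mathrm{e}^{\mathrm{i}xA}S(x)\mathrm{e}^{-\mathrm{i}xA^*},\qquad R(x)=\mathrm{e}^{-\mathrm{i}xA}S(x)\mathrm{e}^{\mathrm{i}xA^*}\qquad(x\ge0).$$ These are positive definite, monotonically nondecreasing matrix functions of $x$, so the limits $$\varkappa_Q:=\lim_{x\to\infty}Q(x)^{-1},\qquad \varkappa_R:=\lim_{x\to\infty}R(x)^{-1}$$ exist. *)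

(* Defs.v *)
From HB Require Import structures.
From mathcomp Require Import all_boot all_order all_algebra.
From mathcomp Require Import spectral sesquilinear complex.
From mathcomp Require Import all_classical all_reals all_analysis.

Set Implicit Arguments.
Unset Strict Implicit.
Unset Printing Implicit Defensive.

Import Order.TTheory GRing.Theory Num.Theory.
Import numFieldNormedType.Exports.

Local Open Scope classical_set_scope.
Local Open Scope ring_scope.
Local Open Scope sesquilinear_scope.

(* The topology of a numFieldType is not inferred for the concrete type R[i]:
   copy it from the regular module R[i]^o, as the library does for abstract
   numeric fields.  'M[R[i]]_(p, q) then gets the entrywise topology. *)
#[non_forgetful_inheritance]
HB.instance Definition _ (R : realType) := GRing.ComAlgebra.copy R[i] R[i]^o.
#[non_forgetful_inheritance]
HB.instance Definition _ (R : realType) := Vector.copy R[i] R[i]^o.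
#[non_forgetful_inheritance]
HB.instance Definition _ (R : realType) := NormedModule.copy R[i] R[i]^o.
HB.instance Definition _ (R : realType) := Num.ClosedField.on R[i].

(* M > 0.  The order of R[i] is partial: 0 < z means that z is real and
   positive. *)
Definition posdefmx (R : realType) (n : nat) (M : 'M[R[i]]_n) : Prop :=
  M ^t* = M /\ forall v : 'cV[R[i]]_n, v != 0 -> 0 < (v ^t* *m M *m v) 0 0.

Definition expmx (R : realType) (n : nat) (M : 'M[R[i]]_n) : 'M[R[i]]_n :=
  limn (series (fun k => (k`!%:R)^-1 *: M ^+ k)).

(* e^(i x A) *)
Definition expimx (R : realType) (n : nat) (A : 'M[R[i]]_n) (x : R) :
    'M[R[i]]_n :=
  expmx (('i * (x%:C)%C) *: A).

Definition integralmx (R : realType) (p q : nat) (a b : R)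
    (F : R -> 'M[R[i]]_(p, q)) : 'M[R[i]]_(p, q) :=
  \matrix_(k, l)
    ((\int[lebesgue_measure]_(t in `[a, b]) complex.Re (F t k l))
     +i* (\int[lebesgue_measure]_(t in `[a, b]) complex.Im (F t k l)))%C.

Definition jmx (R : realType) (m1 m2 : nat) : 'M[R[i]]_(m1 + m2) :=
  block_mx 1%:M 0 0 (- 1%:M).

Section DarbouxMatrices.
Context (R : realType) (n m1 m2 : nat).
Context (A S0 : 'M[R[i]]_n) (th1 : 'M[R[i]]_(n, m1)) (th2 : 'M[R[i]]_(n, m2)).

Local Notation j := (jmx R m1 m2).

Definition Pimx (x : R) : 'M[R[i]]_(n, m1 + m2) :=
  row_mx (expimx A (- x) *m th1) (expimx A x *m th2).

Definition Smx (x : R) : 'M[R[i]]_n :=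
  S0 + integralmx 0 x (fun xi => Pimx xi *m Pimx xi ^t*).

Definition wA (x : R) (lambda : R[i]) : 'M[R[i]]_(m1 + m2) :=
  1%:M - 'i *: (j *m Pimx x ^t* *m invmx (Smx x)
                *m invmx (A - lambda%:M) *m Pimx x).

Definition umx (x : R) : 'M[R[i]]_(m1 + m2) :=
  (1%:M - 'i *: (j *m Pimx x ^t* *m invmx (Smx x) *m invmx A *m Pimx x))
  *m (1%:M + 'i *: (j *m Pimx 0 ^t* *m (invmx A) ^t* *m invmx (Smx 0)
                    *m Pimx 0)).

Definition Ymx (x t : R) : 'M[R[i]]_(m1 + m2, n) :=
  umx x ^t* *m j *m Pimx x ^t* *m invmx (Smx x) *m expimx A t.

(* e^(-i x A^* ) is expimx (A ^t* ) (- x). *)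
Definition Qmx (x : R) : 'M[R[i]]_n :=
  expimx A x *m Smx x *m expimx (A ^t*) (- x).

Definition Rmx (x : R) : 'M[R[i]]_n :=
  expimx A (- x) *m Smx x *m expimx (A ^t*) x.

Definition kappaQ : 'M[R[i]]_n := lim (invmx (Qmx x) @[x --> +oo]).

Definition kappaR : 'M[R[i]]_n := lim (invmx (Rmx x) @[x --> +oo]).

End DarbouxMatrices.

(* Main.v *)
(** Write [M^H] for the conjugate transpose, [E x] for [e^(ixA)],
    [Q = E S E^H], [K = Q^-1], [G x = e^(2ixA) th2] and [F = K G].
    The identity [A S - S A^H = i Pi j Pi^H] persists for all [x], and it turns
    the derivatives into [Q' = 2 G G^H], [K' = - 2 F F^H] and
    [A Q - Q A^H = i (th1 th1^H - G G^H)].  The last one makes the equation of [F]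
    linear with bounded coefficients: [F' = (2 i A^H - 2 K th1 th1^H) F].  Hence
    [phi = tr (F F^H)] satisfies [|phi'| <= C phi] while [tr K >= 0] has derivative
    [- 2 phi], and both [phi +- (C / 2) tr K] are monotone and bounded on one side:
    [phi] converges, and its limit is 0 because [tr K] is bounded below.  The same
    domination makes every entry of [K] converge.  The statements for [R] are those
    for [Q] with [(A, th1, th2)] replaced by [(- A, th2, th1)].

    Finally [Y = u^H j . Pi^H S^-1 . e^(itA)], where the blocks of [Pi^H S^-1] are
    [th1^H Q^-1 E x] and [th2^H R^-1 E (- x)], and
    [u^H j = j wA(0,0) (1 + i j Pi^H (A^-1)^H S^-1 Pi)]; in the last factor the diagonal
    blocks converge since [Q^-1] and [R^-1] do, and the off-diagonal blocks contain
    the factor [F], so they vanish in the limit. *)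

Require Import Defs.
From HB Require Import structures.
From mathcomp Require Import all_boot all_order all_algebra.
From mathcomp Require Import spectral sesquilinear complex.
From mathcomp Require Import all_classical all_reals all_analysis.
From mathcomp Require Import perm ring lra.

Set Implicit Arguments.
Unset Strict Implicit.
Unset Printing Implicit Defensive.

Import Order.TTheory GRing.Theory Num.Theory.
Import numFieldNormedType.Exports.

Local Open Scope classical_set_scope.
Local Open Scope ring_scope.
Local Open Scope sesquilinear_scope.

(** * Complex numbers and matrices: parts and limits *)

Section ComplexParts.
Context {R : realType}.
Implicit Types (z w : R[i]) (a : R).

Lemma complex_ext z w : complex.Re z = complex.Re w -> complex.Im z = complex.Im w -> z = w.
Proof. by case: z w => a b [c d] /= -> ->. Qed.

Lemma cReD z w : complex.Re (z + w) = complex.Re z + complex.Re w.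
Proof. by case: z w => a b [c d]. Qed.

Lemma cImD z w : complex.Im (z + w) = complex.Im z + complex.Im w.
Proof. by case: z w => a b [c d]. Qed.

Lemma cReN z : complex.Re (- z) = - complex.Re z.
Proof. by case: z. Qed.

Lemma cImN z : complex.Im (- z) = - complex.Im z.
Proof. by case: z. Qed.

Lemma cReM z w : complex.Re (z * w) =
  complex.Re z * complex.Re w - complex.Im z * complex.Im w.
Proof. by case: z w => a b [c d]. Qed.

Lemma cImM z w : complex.Im (z * w) =
  complex.Re z * complex.Im w + complex.Im z * complex.Re w.
Proof. by case: z w => a b [c d]. Qed.

Lemma cRe_conj z : complex.Re z^* = complex.Re z.
Proof. by case: z. Qed.

Lemma cIm_conj z : complex.Im z^* = - complex.Im z.
Proof. by case: z. Qed.

Lemma cRe_sum I (r : seq I) (P : pred I) (F : I -> R[i]) :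
  complex.Re (\sum_(i <- r | P i) F i) = \sum_(i <- r | P i) complex.Re (F i).
Proof. by apply: (big_morph _ cReD). Qed.

Lemma cIm_sum I (r : seq I) (P : pred I) (F : I -> R[i]) :
  complex.Im (\sum_(i <- r | P i) F i) = \sum_(i <- r | P i) complex.Im (F i).
Proof. by apply: (big_morph _ cImD). Qed.

Lemma cRe_realM a z : complex.Re (a%:C%C * z) = a * complex.Re z.
Proof. by rewrite cReM /= mul0r subr0. Qed.

Lemma cIm_realM a z : complex.Im (a%:C%C * z) = a * complex.Im z.
Proof. by rewrite cImM /= mul0r addr0. Qed.

Lemma cRe_natM m z : complex.Re (m%:R * z) = m%:R * complex.Re z.
Proof. by rewrite -(rmorph_nat (real_complex R)) cRe_realM. Qed.

Lemma cIm_natM m z : complex.Im (m%:R * z) = m%:R * complex.Im z.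
Proof. by rewrite -(rmorph_nat (real_complex R)) cIm_realM. Qed.

Lemma cRe_iM z : complex.Re ('i * z) = - complex.Im z.
Proof. by rewrite -complexiE cReM /= mul0r mul1r sub0r. Qed.

Lemma cIm_iM z : complex.Im ('i * z) = complex.Re z.
Proof. by rewrite -complexiE cImM /= mul0r mul1r add0r. Qed.

Lemma normr_Re_le z : `|complex.Re z|%:C%C <= `|z|.
Proof.
rewrite normc_def lecR -sqrtr_sqr ler_sqrt ?addr_ge0 ?sqr_ge0 //.
by rewrite lerDl sqr_ge0.
Qed.

Lemma normr_Im_le z : `|complex.Im z|%:C%C <= `|z|.
Proof.
rewrite normc_def lecR -sqrtr_sqr ler_sqrt ?addr_ge0 ?sqr_ge0 //.
by rewrite lerDr sqr_ge0.
Qed.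

Lemma normr_le_ReIm z : `|z| <= (`|complex.Re z| + `|complex.Im z|)%:C%C.
Proof.
rewrite {1}[z]complexE (le_trans (ler_normD _ _))// rmorphD/= lerD//.
  by rewrite normc_def /= expr0n addr0 sqrtr_sqr.
by rewrite normrM !normc_def /= !expr0n/= expr1n addr0 add0r sqrtr1 mul1r sqrtr_sqr.
Qed.

(** The modulus on [R[i]] takes its values in [R[i]]; this l1 norm is real-valued and still
    subadditive and submultiplicative, which suits real estimates. *)
Definition norm1c z : R := `|complex.Re z| + `|complex.Im z|.

Lemma norm1c_ge0 z : 0 <= norm1c z.
Proof. by rewrite addr_ge0. Qed.

Lemma norm1cD z w : norm1c (z + w) <= norm1c z + norm1c w.
Proof. by rewrite /norm1c cReD cImD addrACA lerD// ler_normD. Qed.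

Lemma norm1cM z w : norm1c (z * w) <= norm1c z * norm1c w.
Proof.
rewrite /norm1c cReM cImM mulrDl !mulrDr -!normrM.
rewrite (le_trans (lerD (ler_normB _ _) (ler_normD _ _)))//.
by rewrite le_eqVlt; apply/orP; left; apply/eqP; ring.
Qed.

Lemma norm1c_sum (I : Type) (r : seq I) (F : I -> R[i]) :
  norm1c (\sum_(k <- r) F k) <= \sum_(k <- r) norm1c (F k).
Proof.
elim: r => [|k r IH]; first by rewrite !big_nil /norm1c normr0 addr0.
by rewrite !big_cons (le_trans (norm1cD _ _))// lerD2l.
Qed.

End ComplexParts.

(** * Algebra of the conjugate transpose *)

Section ConjugateTranspose.
Context {R : realType}.

Lemma trmxC1 n : (1%:M : 'M[R[i]]_n) ^t* = 1%:M.
Proof. by rewrite trmx1 map_mx1. Qed.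

Lemma trmxCD p q (M N : 'M[R[i]]_(p, q)) : (M + N) ^t* = M ^t* + N ^t*.
Proof. by rewrite linearD /= map_mxD. Qed.

Lemma trmxCN p q (M : 'M[R[i]]_(p, q)) : (- M) ^t* = - M ^t*.
Proof. by rewrite linearN /= map_mxN. Qed.

Lemma trmxC_iZ p q (M : 'M[R[i]]_(p, q)) : ('i *: M) ^t* = - ('i *: M ^t*).
Proof. by rewrite linearZ /= map_mxZ /= conjCi scaleNr. Qed.

Lemma trmxC_mul p q r (M : 'M[R[i]]_(p, q)) (N : 'M[R[i]]_(q, r)) :
  (M *m N) ^t* = N ^t* *m M ^t*.
Proof. by rewrite trmx_mul map_mxM. Qed.

Lemma trmxC_inv n (M : 'M[R[i]]_n) : (invmx M) ^t* = invmx (M ^t*).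
Proof. by rewrite trmx_inv map_invmx. Qed.

Lemma trmxC_sum p q (I : Type) (r : seq I) (F : I -> 'M[R[i]]_(p, q)) :
  (\sum_(k <- r) F k) ^t* = \sum_(k <- r) (F k) ^t*.
Proof.
by apply: (big_morph (fun M => M ^t*)) => [M N|]; rewrite ?trmxCD// trmx0 map_mx0.
Qed.

End ConjugateTranspose.

(** * Limits of complex numbers and matrices, part by part and entry by entry *)

Section ComplexTopology.
Context {R : realType} {T : Type} {F : set_system T} {FF : Filter F}.

Lemma cvg_complexP (f : T -> R[i]) (l : R[i]) :
  f x @[x --> F] --> l <->
  complex.Re (f x) @[x --> F] --> complex.Re l /\
  complex.Im (f x) @[x --> F] --> complex.Im l.
Proof.
split=> [fl|[fR fI]].
  split; apply/cvgrPdist_lt => e e0; have e0' : (0 : R[i]) < e%:C%C by rewrite ltcR.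
    near=> x; rewrite -cReN -cReD -ltcR (le_lt_trans (normr_Re_le _))//.
    by near: x; move/cvgrPdist_lt : fl; apply.
  near=> x; rewrite -cImN -cImD -ltcR (le_lt_trans (normr_Im_le _))//.
  by near: x; move/cvgrPdist_lt : fl; apply.
apply/cvgrPdist_lt => e; rewrite ltcE => /andP[/eqP/= eI e0].
(* A positive element for the partial order of [R[i]] is real, so the estimate descends to [R]. *)
have -> : e = (complex.Re e)%:C%C by exact: complex_ext.
near=> x; rewrite (le_lt_trans (normr_le_ReIm _))// ltcR cReD cImD cReN cImN.
rewrite [ltRHS]splitr ltrD//; near: x; apply: cvgr_dist_lt => //; rewrite divr_gt0//.
Unshelve. all: by end_near. Qed.

Lemma cvg_mxP p q (f : T -> 'M[R[i]]_(p, q)) (l : 'M[R[i]]_(p, q)) :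
  f x @[x --> F] --> l <-> forall i j, f x i j @[x --> F] --> l i j.
Proof.
split=> [fl i j|fl].
  apply: (@cvg_comp _ _ _ f (fun M : 'M[R[i]]_(p, q) => M i j) _ _ _ fl).
  exact: coord_continuous.
move=> A [P lP PA]; have H : \forall x \near F, forall i j, P i j (f x i j).
  by apply: filter_forall => i; apply: filter_forall => j; exact: fl (lP i j).
by apply: filterS H => x Px; exact: PA.
Qed.

Lemma cvg_mulmx p q r (f : T -> 'M[R[i]]_(p, q)) (g : T -> 'M[R[i]]_(q, r))
    (a : 'M[R[i]]_(p, q)) (b : 'M[R[i]]_(q, r)) :
  f x @[x --> F] --> a -> g x @[x --> F] --> b ->
  (f x *m g x) @[x --> F] --> a *m b.
Proof.
move=> /cvg_mxP fa /cvg_mxP gb; apply/cvg_mxP => i j.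
under eq_fun do rewrite mxE; rewrite mxE.
apply: cvg_big => [|k _]; [exact: add_continuous|exact: cvgM].
Qed.

Lemma cvg_trmxC p q (f : T -> 'M[R[i]]_(p, q)) (a : 'M[R[i]]_(p, q)) :
  f x @[x --> F] --> a -> (f x) ^t* @[x --> F] --> a ^t*.
Proof.
move=> /cvg_mxP fa; apply/cvg_mxP => i j.
under eq_fun do rewrite !mxE; rewrite !mxE.
have /cvg_complexP[fR fI] := fa j i; apply/cvg_complexP; split.
  by under eq_fun do rewrite cRe_conj; rewrite cRe_conj.
by under eq_fun do rewrite cIm_conj; rewrite cIm_conj; exact: cvgN.
Qed.

End ComplexTopology.

(** * Derivatives of complex and matrix functions of a real variable *)

Section ComplexDerivative.
Context {R : realType}.
Implicit Types (f g : R -> R[i]) (x : R) (d e : R[i]).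

(** [R[i]] carries a normed module structure over [R[i]] only, so derivatives in
    a real variable are taken on the real and imaginary parts. *)
Definition cderive f x d :=
  is_derive x 1 (fun t => complex.Re (f t)) (complex.Re d) /\
  is_derive x 1 (fun t => complex.Im (f t)) (complex.Im d).

Lemma cderive_unique f x d e : cderive f x d -> cderive f x e -> d = e.
Proof. by case=> [[_ rd] [_ id]] [[_ re] [_ ie]]; apply: complex_ext; congruence. Qed.

Lemma cderive_near f g x d :
  (\forall t \near x, f t = g t) -> cderive f x d -> cderive g x d.
Proof.
move=> fg [fR fI]; split.
- apply: near_eq_is_derive fR.
  by apply: filterS fg => t ->.
- apply: near_eq_is_derive fI.
  by apply: filterS fg => t ->.
Qed.

Lemma cderive_cst d x : cderive (fun=> d) x 0.
Proof. by split; exact: is_derive_cst. Qed.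

Lemma cderiveD f g x d e :
  cderive f x d -> cderive g x e -> cderive (fun t => f t + g t) x (d + e).
Proof.
move=> [fR fI] [gR gI]; split.
  by under eq_fun do rewrite cReD; rewrite cReD; exact: is_deriveD.
by under eq_fun do rewrite cImD; rewrite cImD; exact: is_deriveD.
Qed.

Lemma cderiveN f x d : cderive f x d -> cderive (fun t => - f t) x (- d).
Proof.
move=> [fR fI]; split.
  by under eq_fun do rewrite cReN; rewrite cReN; exact: is_deriveN.
by under eq_fun do rewrite cImN; rewrite cImN; exact: is_deriveN.
Qed.

Lemma cderiveM f g x d e : cderive f x d -> cderive g x e ->
  cderive (fun t => f t * g t) x (d * g x + f x * e).
Proof.
move=> [fR fI] [gR gI]; split.
  under eq_fun do rewrite cReM.
  apply: is_derive_eq; rewrite !(cReD, cReM) /GRing.scale /=; ring.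
under eq_fun do rewrite cImM.
apply: is_derive_eq; rewrite !(cImD, cImM) /GRing.scale /=; ring.
Qed.

Lemma cderive_conj f x d : cderive f x d -> cderive (fun t => (f t)^*) x d^*.
Proof.
move=> [fR fI]; split.
  by under eq_fun do rewrite cRe_conj; rewrite cRe_conj.
by under eq_fun do rewrite cIm_conj; rewrite cIm_conj; exact: is_deriveN.
Qed.

Lemma cderive_sum (I : Type) (r : seq I) (P : pred I) (F : I -> R -> R[i]) (D : I -> R[i]) x :
  (forall i, P i -> cderive (F i) x (D i)) ->
  cderive (fun t => \sum_(i <- r | P i) F i t) x (\sum_(i <- r | P i) D i).
Proof.
move=> FD; elim: r => [|i r IH].
  rewrite big_nil; under eq_fun do rewrite big_nil; exact: cderive_cst.
rewrite big_cons; under eq_fun do rewrite big_cons.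
by case: ifP => // Pi; apply: cderiveD => //; exact: FD.
Qed.

Lemma cderive_comp f (g : R -> R) x (c : R) d :
  is_derive x 1 g c -> cderive f (g x) d ->
  cderive (fun t => f (g t)) x (c%:C%C * d).
Proof.
move=> gc [fR fI]; split.
  rewrite cRe_realM mulrC.
  exact: (@is_derive1_comp _ (fun t => complex.Re (f t)) g).
rewrite cIm_realM mulrC.
exact: (@is_derive1_comp _ (fun t => complex.Im (f t)) g).
Qed.

Lemma cderive_continuous f x d : cderive f x d -> {for x, continuous f}.
Proof.
move=> [[fR _] [fI _]]; apply/cvg_complexP; split.
  exact/(@differentiable_continuous _ _ _ _ (fun t => complex.Re (f t)))/derivable1_diffP.
exact/(@differentiable_continuous _ _ _ _ (fun t => complex.Im (f t)))/derivable1_diffP.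
Qed.

Definition cderivable f x := exists d, cderive f x d.

Lemma cderivable_sum (I : Type) (r : seq I) (F : I -> R -> R[i]) x :
  (forall i, cderivable (F i) x) ->
  cderivable (fun t => \sum_(i <- r) F i t) x.
Proof. by move=> /choice[D FD]; exists (\sum_(i <- r) D i); apply: cderive_sum. Qed.

Lemma cderivable_prod (I : Type) (r : seq I) (F : I -> R -> R[i]) x :
  (forall i, cderivable (F i) x) ->
  cderivable (fun t => \prod_(i <- r) F i t) x.
Proof.
move=> FD; elim: r => [|i r [e IH]].
  by exists 0; rewrite (_ : (fun _ => _) = fun=> 1);
    [exact: cderive_cst|apply/funext => t; rewrite big_nil].
have [d Fd] := FD i.
exists (d * \prod_(k <- r) F k x + F i x * e).
rewrite (_ : (fun _ => _) = fun t => F i t * \prod_(k <- r) F k t).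
  exact: cderiveM.
by apply/funext => t; rewrite big_cons.
Qed.

Lemma cderivable_inv f x : f x != 0 -> cderivable f x -> cderivable (fun t => (f t)^-1) x.
Proof.
move=> fx0 [d [fR fI]].
(* [n] is the squared modulus; the inverse of [z] is its conjugate divided by [n]. *)
pose n t := complex.Re (f t) ^+ 2 + complex.Im (f t) ^+ 2.
have n0 : n x != 0.
  move: fx0; rewrite eq_complex /= negb_and /n paddr_eq0 ?sqr_ge0//.
  by rewrite negb_and !sqrf_eq0.
have [dn nD] : exists dn, is_derive x 1 n dn.
  by eexists; apply: is_deriveD.
have nV := is_deriveV n0 nD.
have [u fu] : exists u, is_derive x 1 (fun t => complex.Re (f t)^-1) u.
  rewrite (_ : (fun _ => _) = fun t => complex.Re (f t) * (n t)^-1); last first.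
    by apply/funext => t; rewrite /n; case: (f t).
  by eexists; apply: is_deriveM.
have [v fv] : exists v, is_derive x 1 (fun t => complex.Im (f t)^-1) v.
  rewrite (_ : (fun _ => _) = fun t => - (complex.Im (f t) * (n t)^-1)); last first.
    by apply/funext => t; rewrite /n; case: (f t).
  by eexists; apply: is_deriveN.
by exists (u +i* v)%C.
Qed.

End ComplexDerivative.

Section MatrixDerivative.
Context {R : realType}.

Definition mxderive p q (F : R -> 'M[R[i]]_(p, q)) x (D : 'M[R[i]]_(p, q)) :=
  forall k l, cderive (fun t => F t k l) x (D k l).

Lemma mxderive_eq p q (F : R -> 'M[R[i]]_(p, q)) x D E :
  mxderive F x D -> D = E -> mxderive F x E.
Proof. by move=> ? <-. Qed.

Lemma mxderive_unique p q (F : R -> 'M[R[i]]_(p, q)) x D E :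
  mxderive F x D -> mxderive F x E -> D = E.
Proof. by move=> FD FE; apply/matrixP => k l; exact: cderive_unique (FD k l) (FE k l). Qed.

Lemma mxderive_near p q (F G : R -> 'M[R[i]]_(p, q)) x D :
  (\forall t \near x, F t = G t) -> mxderive F x D -> mxderive G x D.
Proof.
by move=> FG FD k l; apply: cderive_near (FD k l); apply: filterS FG => t ->.
Qed.

Lemma mxderive_cst p q (C : 'M[R[i]]_(p, q)) x : mxderive (fun=> C) x 0.
Proof. by move=> k l; rewrite mxE; exact: cderive_cst. Qed.

Lemma mxderiveD p q (F G : R -> 'M[R[i]]_(p, q)) x D E :
  mxderive F x D -> mxderive G x E -> mxderive (fun t => F t + G t) x (D + E).
Proof.
by move=> FD GE k l; rewrite mxE; under eq_fun do rewrite mxE; exact: cderiveD.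
Qed.

Lemma mxderiveN p q (F : R -> 'M[R[i]]_(p, q)) x D :
  mxderive F x D -> mxderive (fun t => - F t) x (- D).
Proof.
by move=> FD k l; rewrite mxE; under eq_fun do rewrite mxE; exact: cderiveN.
Qed.

Lemma mxderiveB p q (F G : R -> 'M[R[i]]_(p, q)) x D E :
  mxderive F x D -> mxderive G x E -> mxderive (fun t => F t - G t) x (D - E).
Proof. by move=> FD GE; apply: mxderiveD => //; exact: mxderiveN. Qed.

Lemma mxderiveM p q r (F : R -> 'M[R[i]]_(p, q)) (G : R -> 'M[R[i]]_(q, r)) x D E :
  mxderive F x D -> mxderive G x E ->
  mxderive (fun t => F t *m G t) x (D *m G x + F x *m E).
Proof.
move=> FD GE k l; under eq_fun do rewrite mxE.
by rewrite !mxE -big_split /=; apply: cderive_sum => i _; exact: cderiveM.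
Qed.

Lemma mxderiveMl p q r (C : 'M[R[i]]_(p, q)) (G : R -> 'M[R[i]]_(q, r)) x E :
  mxderive G x E -> mxderive (fun t => C *m G t) x (C *m E).
Proof.
move=> GE; apply: mxderive_eq (mxderiveM (mxderive_cst C x) GE) _.
by rewrite mul0mx add0r.
Qed.

Lemma mxderiveMr p q r (C : 'M[R[i]]_(q, r)) (F : R -> 'M[R[i]]_(p, q)) x D :
  mxderive F x D -> mxderive (fun t => F t *m C) x (D *m C).
Proof.
move=> FD; apply: mxderive_eq (mxderiveM FD (mxderive_cst C x)) _.
by rewrite mulmx0 addr0.
Qed.

Lemma mxderiveZ p q (c : R[i]) (F : R -> 'M[R[i]]_(p, q)) x D :
  mxderive F x D -> mxderive (fun t => c *: F t) x (c *: D).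
Proof.
move=> FD; under eq_fun do rewrite -mul_scalar_mx; rewrite -mul_scalar_mx.
exact: mxderiveMl.
Qed.

Lemma mxderive_adj p q (F : R -> 'M[R[i]]_(p, q)) x D :
  mxderive F x D -> mxderive (fun t => (F t) ^t*) x (D ^t*).
Proof.
by move=> FD k l; under eq_fun do rewrite !mxE; rewrite !mxE; exact: cderive_conj.
Qed.

Lemma mxderive_comp p q (F : R -> 'M[R[i]]_(p, q)) (g : R -> R) (x c : R) D :
  is_derive x 1 g c -> mxderive F (g x) D ->
  mxderive (fun t => F (g t)) x (c%:C%C *: D).
Proof.
by move=> gc FD k l; rewrite mxE; exact: (@cderive_comp _ (fun t => F t k l)).
Qed.

Lemma cderivable_det n (F : R -> 'M[R[i]]_n) x :
  (forall k l, cderivable (fun t => F t k l) x) -> cderivable (fun t => \det (F t)) x.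
Proof.
move=> FD; rewrite /determinant; apply: cderivable_sum => s.
have [d Pd] := cderivable_prod (index_enum 'I_n) (fun i => FD i (s i)).
by exists (0 * \prod_i F x i (s i) + (-1) ^+ s * d); apply: cderiveM Pd; exact: cderive_cst.
Qed.

(** The determinant is differentiable, hence continuous. Invertibility on a neighbourhood matters
    because [invmx] is given by cofactors only on invertible matrices. *)
Lemma near_unitmx n (F : R -> 'M[R[i]]_n) x D :
  mxderive F x D -> F x \in unitmx -> \forall t \near x, F t \in unitmx.
Proof.
move=> FD; rewrite unitmxE unitfE => Fx.
have [d detd] : cderivable (fun t => \det (F t)) x.
  by apply: cderivable_det => k l; exists (D k l).
have := cvgr_neq0 _ (cderive_continuous detd) Fx.
by move=> /(_ _); apply: filterS => t; rewrite unitmxE unitfE.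
Qed.

(** Some derivative [E] exists by the cofactor formula; its value then follows by differentiating
    [invmx (F t) *m F t = 1]. *)
Lemma mxderive_inv n (F : R -> 'M[R[i]]_n) x D :
  mxderive F x D -> F x \in unitmx ->
  mxderive (fun t => invmx (F t)) x (- (invmx (F x) *m D *m invmx (F x))).
Proof.
move=> FD Fx; have nFx := near_unitmx FD Fx.
have Fd k l : cderivable (fun t => F t k l) x by exists (D k l).
have [E FE] : exists E, mxderive (fun t => invmx (F t)) x E.
  have : forall kl : 'I_n * 'I_n, exists e, cderive (fun t => invmx (F t) kl.1 kl.2) x e.
    move=> [k l] /=.
    have [c Fc] : cderivable (fun t => cofactor (F t) l k) x.
      have [d dF] : cderivable (fun t => \det (row' l (col' k (F t)))) x.
        by apply: cderivable_det => a b; under eq_fun do rewrite !mxE.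
      exists (0 * \det (row' l (col' k (F x))) + (-1) ^+ (l + k) * d).
      by apply: cderiveM dF; exact: cderive_cst.
    have [d Fdet] : cderivable (fun t => (\det (F t))^-1) x.
      apply: cderivable_inv; first by rewrite -unitfE -unitmxE.
      exact: cderivable_det.
    eexists; apply: cderive_near (cderiveM Fdet Fc).
    by apply: filterS nFx => t Ft; rewrite /invmx Ft !mxE.
  by move=> /choice[e Fe]; exists (\matrix_(k, l) e (k, l)) => k l; rewrite mxE; exact: Fe (k, l).
apply: (mxderive_eq FE).
have FFE := mxderiveM FE FD.
have /(mxderive_unique FFE) /eqP : mxderive (fun t => invmx (F t) *m F t) x 0.
  apply: mxderive_near (mxderive_cst 1%:M x).
  by apply: filterS nFx => t Ft; rewrite mulVmx.
rewrite addr_eq0 => /eqP /(congr1 (mulmx^~ (invmx (F x)))).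
by rewrite mulmxK// mulNmx.
Qed.

Lemma derive0_cst_oy (f : R -> R) (a : R) :
  (forall x, a < x -> is_derive x 1 f 0) ->
  forall x y, a < x -> a < y -> f x = f y.
Proof.
move=> fD x y; wlog xy : x y / x <= y.
  by move=> H ax ay; case: (leP x y) => [/H|/ltW /H]; [exact|by move=> ->].
move=> ax ay.
have fD' z : z \in `]x, y[ -> is_derive z 1 f (cst 0 z).
  by rewrite in_itv /= => /andP[xz _]; apply: fD; exact: lt_trans xz.
have [|z _] := MVT_segment xy fD'; last by rewrite mul0r => /eqP; rewrite subr_eq0 => /eqP.
apply: derivable_within_continuous => z; rewrite in_itv /= => /andP[xz _].
by have [] := fD z (lt_le_trans ax xz).
Qed.

Lemma mxderive0_cst_oy p q (F : R -> 'M[R[i]]_(p, q)) (a : R) :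
  (forall x, a < x -> mxderive F x 0) ->
  forall x y, a < x -> a < y -> F x = F y.
Proof.
move=> FD x y ax ay; apply/matrixP => k l; apply: complex_ext.
  apply: (@derive0_cst_oy (fun t => complex.Re (F t k l)) a) => // z /FD /(_ k l).
  by rewrite mxE => -[].
apply: (@derive0_cst_oy (fun t => complex.Im (F t k l)) a) => // z /FD /(_ k l).
by rewrite mxE => -[].
Qed.

End MatrixDerivative.

(** * The matrix exponential *)

Section DominatedPowerSeries.
Context {R : realType}.

(** Comparison with [C] times the exponential series at [K |x|]. *)
Lemma cvg_pseries_dom (a : R^nat) (C K : R) : 0 <= C -> 0 <= K ->
  (forall m, `|a m| <= C * (K ^+ m / m`!%:R)) ->
  forall x, cvgn (pseries a x).
Proof.
move=> C0 K0 aK x; apply: normed_cvg.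
apply: (@series_le_cvg _ _ (C *: exp_coeff (K * `|x|))) => [m|m|m|].
- exact: normr_ge0.
- by rewrite mulr_ge0// exp_coeff_ge0// mulr_ge0.
- rewrite /= normrM normrX (le_trans (ler_wpM2r _ (aK m))) ?exprn_ge0//.
  rewrite -[leRHS]/(C * ((K * `|x|) ^+ m / m`!%:R)) exprMn.
  by rewrite le_eqVlt; apply/orP; left; apply/eqP; ring.
- exact/is_cvg_seriesZ/is_cvg_series_exp_coeff.
Qed.

(** The factor [m + 1] cancels against the factorial, so formal differentiation only multiplies the
    constant by [K], and the bound can be iterated. *)
Lemma pseries_diffs_dom (a : R^nat) (C K : R) :
  (forall m, `|a m| <= C * (K ^+ m / m`!%:R)) ->
  forall m, `|pseries_diffs a m| <= C * K * (K ^+ m / m`!%:R).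
Proof.
move=> aK m; rewrite /pseries_diffs normrM ger0_norm//.
rewrite (le_trans (ler_wpM2l _ (aK m.+1)))// le_eqVlt; apply/orP; left; apply/eqP.
rewrite factS natrM exprS invfM; field.
by rewrite ?natr1 ?nat1r !pnatr_eq0 -?lt0n ?fact_gt0.
Qed.

End DominatedPowerSeries.

Lemma exprZmx (F : fieldType) n (c : F) (B : 'M[F]_n) m :
  (c *: B) ^+ m = c ^+ m *: B ^+ m.
Proof.
elim: m => [|m IH]; first by rewrite !expr0 scale1r.
by rewrite !exprS IH -!mulmxE -scalemxAl -scalemxAr scalerA.
Qed.

Section MatrixExponential.
Context {R : realType} {n : nat}.
Implicit Types (M B C : 'M[R[i]]_n) (x y : R) (z w : R[i]).

#[local] Hint Extern 0 (is_true (0 <= norm1c _)) => exact: norm1c_ge0 : core.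

Let mxpow_bound B : exists2 K : R, 0 <= K & forall m k l, norm1c ((B ^+ m) k l) <= K ^+ m.
Proof.
(* The sum over all entries dominates each row sum, which is what the induction on the exponent
   consumes. *)
exists (\sum_k \sum_l norm1c (B k l)); first by rewrite !sumr_ge0// => k _; rewrite sumr_ge0.
elim=> [|m IH] k l.
  by rewrite !expr0 mxE /norm1c; case: (k == l); rewrite /= !(normr1, normr0) addr0.
rewrite !exprS -mulmxE mxE (le_trans (norm1c_sum _ _))//.
rewrite (le_trans (ler_sum _ (fun i _ => norm1cM _ _)))//.
rewrite (le_trans (ler_sum _ (fun i _ => ler_wpM2l (norm1c_ge0 _) (IH i l))))//.
rewrite -mulr_suml ler_wpM2r ?exprn_ge0//.
  by rewrite !sumr_ge0// => ? _; rewrite sumr_ge0.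
by rewrite [leRHS](bigD1 k)//= lerDl !sumr_ge0// => ? _; rewrite sumr_ge0.
Qed.

Let expseries M := series (fun m => (m`!%:R)^-1 *: M ^+ m).

(** * Termwise differentiation of the exponential series, with [P] standing for the real or the
    imaginary part *)

Section RealPart.
Context (P : R[i] -> R) (PD : {morph P : z w / z + w}).
Context (PZ : forall x z, P (x%:C%C * z) = x * P z).
Context (PN1 : forall z, `|P z| <= norm1c z).

Let P0 : P 0 = 0.
Proof. by have := PZ 0 0; rewrite mulr0 mul0r. Qed.

Let coef B k l m := P ((B ^+ m) k l) / m`!%:R.

Let part_term B x m k l :
  P (((m`!%:R)^-1 *: (x%:C%C *: B) ^+ m) k l) = coef B k l m * x ^+ m.
Proof.
rewrite exprZmx !mxE -(rmorph_nat (real_complex R)) -rmorphXn -fmorphV.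
by rewrite !PZ /coef; ring.
Qed.

Let part_expseries B x k l :
  (fun N => P (expseries (x%:C%C *: B) N k l)) = pseries (coef B k l) x.
Proof.
apply/funext => N; rewrite /expseries /pseries /series /= summxE (big_morph P PD P0).
by apply: eq_bigr => m _; exact: part_term.
Qed.

Let coef_dom B : exists2 K, 0 <= K &
  forall k l m, `|coef B k l m| <= 1 * (K ^+ m / m`!%:R).
Proof.
have [K K0 BK] := mxpow_bound B; exists K => // k l m.
rewrite mul1r /coef normrM [X in _ * X]ger0_norm ?invr_ge0//.
by rewrite ler_wpM2r ?invr_ge0// (le_trans (PN1 _)).
Qed.

Lemma is_cvg_part_expseries B x k l :
  cvgn (fun N => P (expseries (x%:C%C *: B) N k l)).
Proof.
have [K K0 dom] := coef_dom B.
by rewrite part_expseries; exact: cvg_pseries_dom ler01 K0 (dom k l) _.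
Qed.

(** Each part of each entry is a real power series in [x]; its differentiated coefficients involve
    [B ^+ m.+1 / m!], that is, the terms of [B] times the series. *)
Lemma part_expseries_derive B x k l :
  is_derive x 1 (fun x => limn (fun N => P (expseries (x%:C%C *: B) N k l)))
    (limn (fun N => P ((B *m expseries (x%:C%C *: B) N) k l))).
Proof.
have [K K0 dom] := coef_dom B.
have dom1 := pseries_diffs_dom (dom k l).
have dom2 := pseries_diffs_dom dom1.
rewrite (_ : (fun N => P ((B *m _) k l)) = pseries (pseries_diffs (coef B k l)) x).
  under eq_fun do rewrite part_expseries.
  (* Any radius beyond [|x|] would do: the series and its first two formal derivatives converge
     everywhere. *)
  apply: (@pseries_snd_diffs _ _ (`|x| + 1)).
  - exact: cvg_pseries_dom ler01 K0 (dom k l) _.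
  - by apply: (cvg_pseries_dom _ K0 dom1); rewrite mul1r.
  - by apply: (cvg_pseries_dom _ K0 dom2); rewrite mul1r mulr_ge0.
  - by rewrite [ltRHS]ger0_norm ?addr_ge0// ltrDl.
apply/funext => N; rewrite /expseries /pseries /series /= mulmx_sumr summxE.
rewrite (big_morph P PD P0); apply: eq_bigr => m _.
rewrite -scalemxAr exprZmx -scalemxAr mulmxE -exprS.
rewrite !mxE -(rmorph_nat (real_complex R)) -rmorphXn -fmorphV !PZ.
rewrite /pseries_diffs /coef factS natrM invfM; field.
by rewrite ?natr1 ?nat1r !pnatr_eq0 -?lt0n ?fact_gt0.
Qed.

End RealPart.

Let ReN1 z : `|complex.Re z| <= norm1c z.
Proof. by rewrite lerDl. Qed.

Let ImN1 z : `|complex.Im z| <= norm1c z.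
Proof. by rewrite lerDr. Qed.

(** [expmx] is declared through [limn], which is meaningful only once the series is known to
    converge; convergence is assembled from the parts of the entries. *)
Let cvg_expseriesZ B x : expseries (x%:C%C *: B) @ \oo --> expmx (x%:C%C *: B).
Proof.
have ReC k l := @is_cvg_part_expseries _ (@cReD R) (@cRe_realM R) ReN1 B x k l.
have ImC k l := @is_cvg_part_expseries _ (@cImD R) (@cIm_realM R) ImN1 B x k l.
suff /cvgP cE : expseries (x%:C%C *: B) @ \oo -->
  \matrix_(k, l) (limn (fun N => complex.Re (expseries (x%:C%C *: B) N k l)) +i*
                  limn (fun N => complex.Im (expseries (x%:C%C *: B) N k l)))%C
  by exact: cE.
apply/cvg_mxP => k l; rewrite mxE; apply/cvg_complexP; split.
  exact: ReC.
exact: ImC.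
Qed.

Lemma cvg_expseries M : series (fun m => (m`!%:R)^-1 *: M ^+ m) @ \oo --> expmx M.
Proof. by have := @cvg_expseriesZ M 1; rewrite rmorph1 scale1r. Qed.

Lemma expmx_lim (M E : 'M[R[i]]_n) :
  series (fun m => (m`!%:R)^-1 *: M ^+ m) @ \oo --> E -> expmx M = E.
Proof. by move=> h; rewrite /expmx; apply: (cvg_lim _ h). Qed.

Lemma mxderive_expmx B x :
  mxderive (fun t => expmx (t%:C%C *: B)) x (B *m expmx (x%:C%C *: B)).
Proof.
have BE : (B *m expseries (x%:C%C *: B) N) @[N --> \oo] --> B *m expmx (x%:C%C *: B).
  by apply: cvg_mulmx; [exact: cvg_cst|exact: cvg_expseriesZ].
move=> k l; move/cvg_mxP/(_ k l)/cvg_complexP : BE => [BR BI]; split.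
  have := @part_expseries_derive _ (@cReD R) (@cRe_realM R) ReN1 B x k l.
  rewrite (cvg_lim _ BR)//; congr (is_derive _ _ _ _).
  apply/funext => t; have /cvg_mxP/(_ k l)/cvg_complexP[tR _] := @cvg_expseriesZ B t.
  by rewrite (cvg_lim _ tR).
have := @part_expseries_derive _ (@cImD R) (@cIm_realM R) ImN1 B x k l.
rewrite (cvg_lim _ BI)//; congr (is_derive _ _ _ _).
apply/funext => t; have /cvg_mxP/(_ k l)/cvg_complexP[_ tI] := @cvg_expseriesZ B t.
by rewrite (cvg_lim _ tI).
Qed.

Lemma expmx0 : expmx 0 = 1%:M :> 'M[R[i]]_n.
Proof.
(* Partial sums equal the identity from index 1 on; the one of index 0 is empty. *)
apply: expmx_lim; apply/cvgrPdist_lt => e e0; exists 1%N => // N /= N1'.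
rewrite /series /= -(prednK N1') big_nat_recl//= expr0 fact0 invr1 scale1r.
rewrite big1 ?addr0 ?subrr ?normr0// => m _.
by rewrite exprS mul0r scaler0.
Qed.

(** [C] commutes with every partial sum, and limits are unique. *)
Lemma expmx_comm C M : C *m M = M *m C -> C *m expmx M = expmx M *m C.
Proof.
move=> CM; have cC : (fun=> C) x @[x --> \oo] --> C by exact: cvg_cst.
have h1 := cvg_mulmx cC (@cvg_expseries M).
have h2 := cvg_mulmx (@cvg_expseries M) cC.
have e : (fun N => C *m series (fun m => (m`!%:R)^-1 *: M ^+ m) N) =
         (fun N => series (fun m => (m`!%:R)^-1 *: M ^+ m) N *m C).
  apply/funext => N; rewrite /series /= mulmx_sumr mulmx_suml.
  apply: eq_bigr => m _; rewrite -scalemxAr -scalemxAl; congr (_ *: _).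
  elim: m => [|m IH]; first by rewrite expr0 mulmx1 mul1mx.
  by rewrite exprS -mulmxE mulmxA CM -mulmxA IH mulmxA.
rewrite e in h1; rewrite -(cvg_lim _ (h1 _))//; exact: (cvg_lim _ (h2 _)).
Qed.

Lemma expmx_trmxC M : (expmx M) ^t* = expmx (M ^t*).
Proof.
symmetry; apply: expmx_lim.
rewrite (_ : series _ = fun N => (series (fun m => (m`!%:R)^-1 *: M ^+ m) N) ^t*).
  exact: cvg_trmxC (@cvg_expseries M).
apply/funext => N; rewrite /series /=.
rewrite trmxC_sum; apply: eq_bigr => m _.
rewrite linearZ /= map_mxZ fmorphV rmorph_nat; congr (_ *: _).
have -> : (M ^t*) ^+ m = (M ^+ m) ^t*.
  elim: m => [|m IH]; first by rewrite !expr0 trmx1 map_mx1.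
  by rewrite exprSr IH exprS -!mulmxE trmx_mul map_mxM.
by [].
Qed.

End MatrixExponential.

Section Exponential.
Context {R : realType} {n : nat}.
Implicit Types (A C : 'M[R[i]]_n) (x y : R).

Lemma expimxE A x : expimx A x = expmx (x%:C%C *: ('i *: A)).
Proof. by rewrite scalerA mulrC. Qed.

Lemma expimx0 A : expimx A 0 = 1%:M.
Proof. by rewrite expimxE scale0r expmx0. Qed.

Lemma expimxN A x : expimx (- A) x = expimx A (- x).
Proof. by rewrite !expimxE scalerN rmorphN scaleNr scalerN. Qed.

Lemma expimx_comm A C x : C *m A = A *m C -> C *m expimx A x = expimx A x *m C.
Proof.
by move=> CA; apply: expmx_comm; rewrite -scalemxAl -scalemxAr CA.
Qed.

Lemma mxderive_expimx A x : mxderive (expimx A) x ('i *: (A *m expimx A x)).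
Proof.
rewrite (_ : expimx A = fun t => expmx (t%:C%C *: ('i *: A))); last first.
  by apply/funext => t; exact: expimxE.
rewrite scalemxAl; exact: mxderive_expmx.
Qed.

Lemma mxderive_expimx_affine A (c y x : R) :
  mxderive (fun t => expimx A (c * t + y)) x ((c%:C%C * 'i) *: (A *m expimx A (c * x + y))).
Proof.
have cD : is_derive x 1 (fun t => c * t + y) c.
  have -> : (fun t => c * t + y) = (c *: (id : R -> R) + cst y) by [].
  by apply: is_derive_eq; rewrite /GRing.scale /= mulr1 addr0.
by rewrite -scalerA; exact: mxderive_comp cD (mxderive_expimx A _).
Qed.

(** The product of [e^(i(t+a)A)] and [e^(-itA)] has zero derivative in [t], so it keeps its value
    [e^(iaA)] at 0. *)
Lemma expimxD A x y : expimx A (x + y) = expimx A x *m expimx A y.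
Proof.
(* The arguments are spelled [c * t + y] to fit [mxderive_expimx_affine]. *)
pose h a t := expimx A (1 * t + a) *m expimx A (-1 * t + 0).
have hD a t : mxderive (h a) t 0.
  apply: mxderive_eq (mxderiveM (mxderive_expimx_affine _ _ _ _)
    (mxderive_expimx_affine _ _ _ _)) _.
  have -> : (- 1)%:C%C * 'i = - 'i :> R[i] by rewrite rmorphN1 mulN1r.
  rewrite rmorph1 [1 * 'i]mul1r scaleNr mulmxN -scalemxAl -scalemxAr mulmxA.
  by rewrite (@expimx_comm A A)// subrr.
have hE a t : expimx A (t + a) *m expimx A (- t) = expimx A a.
  have h0 : h a 0 = expimx A a.
    by rewrite /h (mulr0 1) (mulr0 (-1)) (add0r a) (addr0 0) expimx0 mulmx1.
  have ht : expimx A (t + a) *m expimx A (- t) = h a t.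
    by rewrite /h (mul1r t) (mulN1r t) (addr0 (- t)).
  rewrite -h0 ht.
  (* The left end [- |t| - 1] lies below both [t] and 0. *)
  apply: (@mxderive0_cst_oy _ _ _ (h a) (- `|t| - 1)) => [z _| |]; first exact: hD.
    by have := ler_norm (- t); rewrite normrN; lra.
  by have := normr_ge0 t; lra.
have EV t : expimx A (- t) *m expimx A t = 1%:M.
  by have := hE 0 (- t); rewrite addr0 opprK expimx0.
rewrite (addrC x y); move: (expimx A (y + x)) (hE x y) => E <-.
by rewrite -mulmxA (EV y) mulmx1.
Qed.

Lemma expimxNx A x : expimx A (- x) *m expimx A x = 1%:M.
Proof. by rewrite -expimxD addNr expimx0. Qed.

Lemma expimx_trmxC A x : (expimx A x) ^t* = expimx (A ^t*) (- x).
Proof.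
rewrite /expimx expmx_trmxC; congr expmx; apply/matrixP => k l; rewrite !mxE.
rewrite rmorphM /=; congr (_ * _); apply: complex_ext.
  by rewrite cRe_conj !cRe_iM /= oppr0.
by rewrite cIm_conj !cIm_iM.
Qed.

End Exponential.

(** * Antiderivatives by the fundamental theorem of calculus *)

Section Antiderivative.
Context {R : realType}.

Lemma continuous_antiderivative (f : R -> R) : continuous f ->
  exists2 G : R -> R, forall x : R, -1 < x -> is_derive x 1 G (f x) &
    forall x : R, 0 <= x -> \int[lebesgue_measure]_(t in `[0, x]) f t = G x - G 0.
Proof.
move=> cf.
have intf a b : lebesgue_measure.-integrable `[a, b] (EFin \o f).
  apply: continuous_compact_integrable; first exact: segment_compact.
  exact: continuous_subspaceT.
(* Integrating from -1 makes 0 an interior point, so the derivative there is two-sided. *)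
exists (fun x => \int[lebesgue_measure]_(t in `[-1, x]) f t) => x x0.
  have x1 : x < x + 1 by rewrite ltrDl.
  have [dG GE] := continuous_FTC1_closed x1 (intf _ _) x0 (cf x).
  by rewrite derive1E in GE; apply: DeriveDef.
rewrite (@Rintegral_itvB _ f (BLeft (-1)) (BRight x) 0)//.
- rewrite Rintegral_itv_obnd_cbnd//.
  by apply: integrableS (intf 0 x) => //; exact: subset_itv_oc_cc.
- by rewrite bnd_simp lerN10.
Qed.

Lemma mx_antiderivative p q (F D : R -> 'M[R[i]]_(p, q)) :
  (forall x, mxderive F x (D x)) ->
  exists2 G : R -> 'M[R[i]]_(p, q), forall x, -1 < x -> mxderive G x (F x) &
    forall x : R, 0 <= x -> integralmx 0 x F = G x - G 0.
Proof.
move=> FD.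
have cF k l : continuous (fun t => F t k l) by move=> x; exact: cderive_continuous (FD x k l).
have /choice[G GP] : forall kl : 'I_p * 'I_q, exists G : R -> R[i],
    (forall x, -1 < x -> cderive G x (F x kl.1 kl.2)) /\
    forall x : R, 0 <= x -> (\int[lebesgue_measure]_(t in `[0%R, x]) complex.Re (F t kl.1 kl.2) +i*
      \int[lebesgue_measure]_(t in `[0%R, x]) complex.Im (F t kl.1 kl.2))%C = G x - G 0.
  move=> [k l] /=.
  have cRe : continuous (fun t => complex.Re (F t k l)).
    by move=> x; have /cvg_complexP[] := cF k l x.
  have cIm : continuous (fun t => complex.Im (F t k l)).
    by move=> x; have /cvg_complexP[] := cF k l x.
  have [G GD GI] := continuous_antiderivative cRe.
  have [H HD HI] := continuous_antiderivative cIm.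
  exists (fun x => (G x +i* H x)%C); split=> x x0; first by split; [exact: GD|exact: HD].
  by rewrite GI// HI.
exists (fun x => \matrix_(k, l) G (k, l) x) => x x0.
  by move=> k l; under eq_fun do rewrite mxE; exact: (GP (k, l)).1.
by apply/matrixP => k l; rewrite !mxE; exact: (GP (k, l)).2.
Qed.

End Antiderivative.

(** * Functions with a dominated derivative *)

Section RealAsymptotics.
Context {R : realType}.
Implicit Types (f df p dp : R -> R).

Lemma derive_le0_nincr f df :
  (forall x : R, 0 <= x -> is_derive x 1 f (df x)) -> (forall x, 0 <= x -> df x <= 0) ->
  forall x y, 0 <= x -> x <= y -> f y <= f x.
Proof.
move=> fD df0 x y x0 xy.
have fD' z : z \in `]x, y[ -> is_derive z 1 f (df z).
  by rewrite in_itv /= => /andP[xz _]; apply: fD; apply: ltW; exact: le_lt_trans xz.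
have [|z + E] := MVT_segment xy fD'.
  apply: derivable_within_continuous => z; rewrite in_itv /= => /andP[xz _].
  by have [] := fD z (le_trans x0 xz).
rewrite in_itv /= => /andP[xz _]; rewrite -subr_le0 E mulr_le0_ge0 ?subr_ge0//.
by apply: df0; rewrite (le_trans x0).
Qed.

Lemma nincr_cvg f (m : R) :
  (forall x y, 0 <= x -> x <= y -> f y <= f x) -> (forall x, 0 <= x -> m <= f x) ->
  exists l : R, f x @[x --> +oo] --> l.
Proof.
(* Freezing [f] at [f 0] on the negative reals makes [g] monotone on the whole line. *)
move=> fni fm; pose g x := - f (Num.max x 0).
have gnd : nondecreasing_fun g.
  move=> x y xy; rewrite /g lerN2; apply: fni; first by rewrite le_max lexx orbT.
  by rewrite ge_max !le_max lexx xy orbT.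
have gub : has_ubound (range g).
  by exists (- m) => _ [x _ <-]; rewrite /g lerN2 fm// le_max lexx orbT.
have gl := nondecreasing_cvgr gnd gub; exists (- sup (range g)).
rewrite -[f]opprK; apply: cvgN.
apply: cvg_trans gl; apply: near_eq_cvg; near=> x.
by rewrite /g max_l.
Unshelve. all: by end_near. Qed.

Section Dominated.
Context (f df p dp : R -> R) (C : R).
Context (C0 : 0 <= C) (fD : forall x : R, 0 <= x -> is_derive x 1 f (df x))
  (pD : forall x : R, 0 <= x -> is_derive x 1 p (dp x))
  (dom : forall x, 0 <= x -> `|df x| <= - (C * dp x))
  (p0 : forall x, 0 <= x -> 0 <= p x).

(** The derivative is at most 0, since [df <= |df| <= - C dp]; the same reasoning applied to [- f]
    gives [sub_nincr]. *)
Let add_nincr x y : 0 <= x -> x <= y -> f y + C * p y <= f x + C * p x.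
Proof.
apply: (@derive_le0_nincr (fun x => f x + C * p x) (fun x => df x + C * dp x)) => {x y} x x0.
  have := fD x0; have := pD x0 => ? ?.
  by apply: (@is_deriveD _ _ _ f (C *: p)).
by have := ler_normlW (dom x0); lra.
Qed.

Let sub_nincr x y : 0 <= x -> x <= y -> - f y + C * p y <= - f x + C * p x.
Proof.
apply: (@derive_le0_nincr (fun x => - f x + C * p x) (fun x => - df x + C * dp x)) => {x y} x x0.
  have := fD x0; have := pD x0 => ? ?.
  by apply: (@is_deriveD _ _ _ (- f) (C *: p)).
by have := dom x0; rewrite ler_norml => /andP[]; lra.
Qed.

Lemma derive_dominated_bounded x : 0 <= x -> `|f x| <= `|f 0| + C * p 0.
Proof.
move=> x0; have := add_nincr (lexx 0) x0; have := sub_nincr (lexx 0) x0.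
have := ler_norm (f 0); have := ler_norm (- f 0); rewrite normrN.
have : 0 <= C * p x by rewrite mulr_ge0// p0.
by rewrite ler_norml => ? ? ? ? ?; apply/andP; split; lra.
Qed.

(** Monotonicity of each of [f + C p] and [- f + C p], together with [p >= 0], bounds the other from
    below. Both converge, and [f] is half their difference. *)
Lemma derive_dominated_cvg : exists l : R, f x @[x --> +oo] --> l.
Proof.
have Cp x : 0 <= x -> 0 <= C * p x by move=> x0; rewrite mulr_ge0// p0.
have [|a fa] := @nincr_cvg _ (f 0 - C * p 0) add_nincr.
  by move=> x x0; have := sub_nincr (lexx 0) x0; have := Cp x x0; lra.
have [|b fb] := @nincr_cvg _ (- f 0 - C * p 0) sub_nincr.
  by move=> x x0; have := add_nincr (lexx 0) x0; have := Cp x x0; lra.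
exists (2^-1 * (a - b)).
rewrite (_ : f = fun x => 2^-1 * ((f x + C * p x) - (- f x + C * p x))).
  by apply: cvgMr; exact: cvgB.
by apply/funext => x; lra.
Qed.

End Dominated.

(** A limit exists by [derive_dominated_cvg]. Were it positive, [p], whose derivative is [- f],
    would eventually decrease at least linearly and become negative. *)
Lemma derive_dominated_cvg0 f df p (C : R) : 0 <= C ->
  (forall x : R, 0 <= x -> is_derive x 1 f (df x)) ->
  (forall x : R, 0 <= x -> is_derive x 1 p (- f x)) ->
  (forall x, 0 <= x -> `|df x| <= C * f x) ->
  (forall x, 0 <= x -> 0 <= f x) ->
  (forall x, 0 <= x -> 0 <= p x) ->
  f x @[x --> +oo] --> 0.
Proof.
move=> C0 fD pD dom f0 p0.
have dom' x : 0 <= x -> `|df x| <= - (C * - f x) by move=> x0; rewrite mulrN opprK dom.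
have [l fl] := derive_dominated_cvg C0 fD pD dom' p0.
suff l0 : l <= 0.
  suff -> : 0 = l by [].
  apply/eqP; rewrite eq_le l0 andbT.
  by apply: (cvgr_to_ge fl); near=> x; exact: f0.
rewrite leNgt; apply/negP => lgt0.
have [N [N0 NP]] : exists N, 0 <= N /\ forall x, N < x -> l / 2 < f x.
  have : \forall x \near +oo, l / 2 < f x.
    by apply: (cvgr_gt l fl); rewrite ltr_pdivrMr// ltr_pMr// ltr1n.
  move=> [M [Mreal MP]]; exists (Num.max M 0); split; first by rewrite le_max lexx orbT.
  by move=> x; rewrite gt_max => /andP[/MP].
(* Beyond [N] the slope of [p] is below [- l / 2], so over this length [p] drops by at least
   [p N + 1]. *)
pose y := N + 2 * (p N + 1) / l.
have c0 : 0 < 2 * (p N + 1) / l by rewrite divr_gt0// mulr_gt0// ltr_wpDl// p0.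
have Ny : N < y by rewrite ltrDl.
have pD' z : z \in `]N, y[ -> is_derive z 1 p (- f z).
  by rewrite in_itv /= => /andP[xz _]; apply: pD; rewrite (le_trans N0)// ltW.
have [|z + E] := MVT Ny pD'.
  apply: derivable_within_continuous => z; rewrite in_itv /= => /andP[xz _].
  by have [] := pD z (le_trans N0 xz).
rewrite in_itv /= => /andP[/NP lf _].
have : p y < 0.
  have -> : p y = p N - f z * (2 * (p N + 1) / l) by rewrite -(subrK (p N) (p y)) E /y; lra.
  rewrite subr_lt0 (@lt_le_trans _ _ (l / 2 * (2 * (p N + 1) / l)))//.
    suff -> : l / 2 * (2 * (p N + 1) / l) = p N + 1 by rewrite ltrDl.
    by field; rewrite gt_eqF.
  by rewrite ler_pM2r// ltW.
by rewrite ltNge p0// (le_trans N0)// ltW.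
Unshelve. all: by end_near. Qed.

End RealAsymptotics.

(** * Positive definite matrices *)

Section Posdef.
Context {R : realType}.

Lemma posdefmx_unit n (M : 'M[R[i]]_n) : posdefmx M -> M \in unitmx.
Proof.
move=> [_ Mpos]; rewrite unitmxE unitfE; apply/negP => /det0P[v v0 vM].
(* [det0P] provides a row in the left kernel; its adjoint is the column that contradicts
   positivity. *)
have /Mpos : v ^t* != 0.
  apply: contra v0 => /eqP vz; apply/eqP.
  by rewrite -[v]trmxCK vz trmx0 map_mx0.
by rewrite trmxCK vM mul0mx mxE ltxx.
Qed.

(** The diagonal entry is the quadratic form of [M] at the [k]-th column of [B]. *)
Lemma posdefmx_diag_ge0 n p (M : 'M[R[i]]_n) (B : 'M[R[i]]_(n, p)) k :
  posdefmx M -> 0 <= (B ^t* *m M *m B) k k.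
Proof.
move=> [_ Mpos].
have -> : (B ^t* *m M *m B) k k = ((col k B) ^t* *m M *m col k B) 0 0.
  rewrite !mxE; apply: eq_bigr => j _; rewrite !mxE; congr (_ * _).
  by apply: eq_bigr => i _; rewrite !mxE.
have [->|c0] := eqVneq (col k B) 0; first by rewrite mulmx0 mxE.
exact/ltW/Mpos.
Qed.

Lemma posdefmx_congr n (M E : 'M[R[i]]_n) :
  posdefmx M -> E \in unitmx -> posdefmx (E *m M *m E ^t*).
Proof.
move=> [Mh Mpos] Eu; split=> [|v v0].
  by rewrite !trmxC_mul trmxCK Mh mulmxA.
have := Mpos (E ^t* *m v); rewrite trmxC_mul trmxCK !mulmxA; apply.
apply: contra v0 => /eqP Ev; apply/eqP.
have Eu' : E ^t* \in unitmx by rewrite map_unitmx unitmx_tr.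
by rewrite -[v](mulKmx Eu') Ev mulmx0.
Qed.

End Posdef.

(** * Boundedness on the nonnegative half-line *)

Section Bounded.
Context {R : realType}.

Definition bounded_oy (f : R -> R[i]) := exists b, forall x, 0 <= x -> norm1c (f x) <= b.

Lemma bounded_oy_cst z : bounded_oy (fun=> z).
Proof. by exists (norm1c z). Qed.

Lemma bounded_oyD f g : bounded_oy f -> bounded_oy g -> bounded_oy (fun x => f x + g x).
Proof.
move=> [b fb] [c gc]; exists (b + c) => x x0.
by rewrite (le_trans (norm1cD _ _))// lerD ?fb ?gc.
Qed.

Lemma bounded_oyM f g : bounded_oy f -> bounded_oy g -> bounded_oy (fun x => f x * g x).
Proof.
move=> [b fb] [c gc]; exists (b * c) => x x0.
by rewrite (le_trans (norm1cM _ _))// ler_pM ?fb ?gc ?norm1c_ge0.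
Qed.

Lemma bounded_oy_sum (I : Type) (r : seq I) (F : I -> R -> R[i]) :
  (forall k, bounded_oy (F k)) -> bounded_oy (fun x => \sum_(k <- r) F k x).
Proof.
move=> /choice[b Fb]; exists (\sum_(k <- r) b k) => x x0.
by rewrite (le_trans (norm1c_sum _ _))// ler_sum// => k _; exact: Fb.
Qed.

Lemma bounded_oy_mulmx p q r (F : R -> 'M[R[i]]_(p, q)) (G : R -> 'M[R[i]]_(q, r)) :
  (forall k l, bounded_oy (fun x => F x k l)) ->
  (forall k l, bounded_oy (fun x => G x k l)) ->
  forall k l, bounded_oy (fun x => (F x *m G x) k l).
Proof.
move=> Fb Gb k l; under eq_fun do rewrite mxE.
by apply: bounded_oy_sum => m; exact: bounded_oyM.
Qed.

Lemma bounded_oy_mx_unif p q (F : R -> 'M[R[i]]_(p, q)) :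
  (forall k l, bounded_oy (fun x => F x k l)) ->
  exists2 b, 0 <= b & forall x k l, 0 <= x -> norm1c (F x k l) <= b.
Proof.
move=> Fb.
have /choice[b bF] : forall kl : 'I_p * 'I_q, exists b,
    forall x, 0 <= x -> norm1c (F x kl.1 kl.2) <= b.
  by move=> kl; exact: Fb.
exists (\sum_kl `|b kl|); first exact: sumr_ge0.
move=> x k l x0; rewrite (le_trans (bF (k, l) x x0))// (bigD1 (k, l))//=.
by rewrite (le_trans (ler_norm _))// lerDl sumr_ge0.
Qed.

End Bounded.

(** * The inverse of Q *)

Section GramMatrix.
Context {R : realType}.

(** The squared Hilbert-Schmidt norm, as a real number. *)
Definition hsnorm2 p q (F : 'M[R[i]]_(p, q)) : R := complex.Re (\tr (F *m F ^t*)).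

Lemma hsnorm2E p q (F : 'M[R[i]]_(p, q)) :
  hsnorm2 F = \sum_k \sum_l (complex.Re (F k l) ^+ 2 + complex.Im (F k l) ^+ 2).
Proof.
rewrite /hsnorm2 /mxtrace cRe_sum; apply: eq_bigr => k _; rewrite mxE cRe_sum.
by apply: eq_bigr => l _; rewrite !mxE cReM cRe_conj cIm_conj; ring.
Qed.

Lemma row_le_hsnorm2 p q (F : 'M[R[i]]_(p, q)) k :
  \sum_l (complex.Re (F k l) ^+ 2 + complex.Im (F k l) ^+ 2) <= hsnorm2 F.
Proof.
rewrite hsnorm2E [leRHS](bigD1 k)//= lerDl sumr_ge0// => i _.
by rewrite sumr_ge0// => l _; rewrite addr_ge0 ?sqr_ge0.
Qed.

Lemma entry_le_hsnorm2 p q (F : 'M[R[i]]_(p, q)) k l :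
  complex.Re (F k l) ^+ 2 + complex.Im (F k l) ^+ 2 <= hsnorm2 F.
Proof.
apply: le_trans (row_le_hsnorm2 F k).
by rewrite [leRHS](bigD1 l)//= lerDl sumr_ge0// => i _; rewrite addr_ge0 ?sqr_ge0.
Qed.

Lemma hsnorm2_ge0 p q (F : 'M[R[i]]_(p, q)) : 0 <= hsnorm2 F.
Proof.
rewrite hsnorm2E sumr_ge0// => k _; rewrite sumr_ge0// => l _.
by rewrite addr_ge0 ?sqr_ge0.
Qed.

(** The entry is the inner product of rows [k] and [l], hence at most the mean of their squared
    norms [s k] and [s l], each bounded by [hsnorm2 F]. *)
Lemma gram_entry_le p q (F : 'M[R[i]]_(p, q)) k l :
  `|complex.Re ((F *m F ^t*) k l)| <= hsnorm2 F /\
  `|complex.Im ((F *m F ^t*) k l)| <= hsnorm2 F.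
Proof.
pose s k := \sum_m (complex.Re (F k m) ^+ 2 + complex.Im (F k m) ^+ 2).
have skl : (s k + s l) / 2 <= hsnorm2 F.
  have := row_le_hsnorm2 F k; have := row_le_hsnorm2 F l; rewrite -/(s k) -/(s l); lra.
rewrite !mxE cRe_sum cIm_sum; split; apply: le_trans skl;
  rewrite (le_trans (ler_norm_sum _ _ _))// /s -big_split /= mulr_suml ler_sum// => m _;
  rewrite !mxE ?cReM ?cImM cRe_conj cIm_conj ler_norml;
  move: (complex.Re (F k m)) (complex.Im (F k m)) => a b;
  move: (complex.Re (F l m)) (complex.Im (F l m)) => c d.
  (* These squares give [2 |a c + b d| <= a^2 + b^2 + c^2 + d^2]; the imaginary part below is
     [b c - a d]. *)
  have := sqr_ge0 (a - c); have := sqr_ge0 (b - d).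
  by have := sqr_ge0 (a + c); have := sqr_ge0 (b + d); move=> *; apply/andP; split; nra.
have := sqr_ge0 (a - d); have := sqr_ge0 (b - c).
by have := sqr_ge0 (a + d); have := sqr_ge0 (b + c); move=> *; apply/andP; split; nra.
Qed.

(** The trace is a sum of [n * n] products of an entry of [X] and an entry of the Gram matrix. This
    is the estimate that bounds the derivative of [phi] by a multiple of [phi]. *)
Lemma trace_gram_le n q (X : 'M[R[i]]_n) (F : 'M[R[i]]_(n, q)) (b : R) :
  (forall k l, norm1c (X k l) <= b) ->
  `|complex.Re (\tr (X *m (F *m F ^t*)))| <= (n * n)%:R * b * hsnorm2 F.
Proof.
move=> Xb; rewrite /mxtrace cRe_sum (le_trans (ler_norm_sum _ _ _))//.
apply: (@le_trans _ _ (\sum_(k < n) \sum_(m < n) b * hsnorm2 F)); last first.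
  by rewrite !sumr_const !card_ord -mulrnA -[leLHS]mulr_natl mulrA.
apply: ler_sum => k _; rewrite mxE cRe_sum (le_trans (ler_norm_sum _ _ _))//.
apply: ler_sum => m _; have [WR WI] := gram_entry_le F m k.
rewrite cReM (le_trans (ler_normB _ _))// !normrM.
rewrite (@le_trans _ _ (norm1c (X k m) * hsnorm2 F))//; last first.
  by rewrite ler_wpM2r ?hsnorm2_ge0.
by rewrite mulrDl lerD// ler_wpM2l.
Qed.

Lemma cvg_hsnorm2_0 T (FT : set_system T) (FF : Filter FT) p q (F : T -> 'M[R[i]]_(p, q)) :
  hsnorm2 (F x) @[x --> FT] --> 0 -> F x @[x --> FT] --> (0 : 'M[R[i]]_(p, q)).
Proof.
move=> F0; apply/cvg_mxP => k l; rewrite mxE.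
have small e : 0 < e -> \forall x \near FT, hsnorm2 (F x) < e ^+ 2.
  by move=> e0; apply: (cvgr_lt _ F0); rewrite exprn_gt0.
apply/cvg_complexP; split; apply/cvgrPdist_lt => e e0; near=> x.
  rewrite sub0r normrN -(@ltr_pXn2r _ 2) ?nnegrE ?normr_ge0 ?ltW//.
  rewrite real_normK ?num_real// (@le_lt_trans _ _ (hsnorm2 (F x)))//.
    apply: le_trans (entry_le_hsnorm2 _ k l); rewrite lerDl; exact: sqr_ge0.
  by near: x; exact: small.
rewrite sub0r normrN -(@ltr_pXn2r _ 2) ?nnegrE ?normr_ge0 ?ltW//.
rewrite real_normK ?num_real// (@le_lt_trans _ _ (hsnorm2 (F x)))//.
  apply: le_trans (entry_le_hsnorm2 _ k l); rewrite lerDr; exact: sqr_ge0.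
by near: x; exact: small.
Unshelve. all: by end_near. Qed.

End GramMatrix.

(** * Linearization of the equation for [F = K G] *)

Section RiccatiAlgebra.
Context {R : realType} {n q : nat} (A K Q W : 'M[R[i]]_n) (G : 'M[R[i]]_(n, q)).
Context (KQ : K *m Q = 1%:M) (QK : Q *m K = 1%:M) (Kh : K ^t* = K).
Context (AQ : A *m Q - Q *m A ^t* = 'i *: (W - G *m G ^t*)).
Let F := K *m G.

(** Multiplying [AQ] by [K] on both sides moves [A] across [K], at the cost of terms quadratic in
    [K]. *)
Let KA : K *m A = A ^t* *m K + 'i *: (K *m W *m K - F *m F ^t*).
Proof.
have := congr1 (fun M => K *m M *m K) AQ.
have -> : K *m (A *m Q - Q *m A ^t*) *m K = K *m A - A ^t* *m K.
  by rewrite mulmxBr mulmxBl (mulmxA K A) -(mulmxA _ Q K) QK mulmx1 (mulmxA K Q) KQ mul1mx.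
have -> : K *m ('i *: (W - G *m G ^t*)) *m K = 'i *: (K *m W *m K - F *m F ^t*).
  by rewrite -scalemxAr -scalemxAl mulmxBr mulmxBl /F trmxC_mul Kh !mulmxA.
by move=> /eqP; rewrite subr_eq addrC => /eqP.
Qed.

(** The terms cubic in [G] cancel. *)
Lemma riccati_linearize :
  - (2 *: (F *m F ^t*)) *m G + K *m ((2 * 'i) *: (A *m G)) =
  ((2 * 'i) *: A ^t* - 2 *: (K *m W)) *m F.
Proof.
rewrite -scalemxAr mulmxA KA mulmxDl mulmxBl -!scalemxAl scalerDr scalerA.
rewrite -mulrA mulCii mulrN1 scaleNr mulNmx -!scalemxAl mulmxBl.
have -> : A ^t* *m K *m G = A ^t* *m F by rewrite /F mulmxA.
have -> : K *m W *m K *m G = K *m W *m F by rewrite /F !mulmxA.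
move: (K *m W *m F) (F *m F ^t* *m G) (A ^t* *m F) => a b c.
apply/matrixP => k l; rewrite !mxE.
by move: (a k l) (b k l) (c k l) 'i => {}a {}b {}c e; ring.
Qed.

End RiccatiAlgebra.

(** * Convergence of [Q^-1] and decay of [Q^-1 G] *)

Section RiccatiAsymptotics.
Context {R : realType} {n p q : nat}.
Context (A : 'M[R[i]]_n) (V : 'M[R[i]]_(n, p)) (Q : R -> 'M[R[i]]_n) (G : R -> 'M[R[i]]_(n, q)).
Context (QD : forall x : R, 0 <= x -> mxderive Q x (2 *: (G x *m (G x) ^t*)))
  (GD : forall x : R, 0 <= x -> mxderive G x ((2 * 'i) *: (A *m G x)))
  (AQ : forall x : R, 0 <= x ->
    A *m Q x - Q x *m A ^t* = 'i *: (V *m V ^t* - G x *m (G x) ^t*))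
  (Qpos : forall x : R, 0 <= x -> posdefmx (Q x)).

Let K (x : R) := invmx (Q x).
Let F (x : R) := K x *m G x.
Let B (x : R) := (2 * 'i) *: A ^t* - 2 *: (K x *m (V *m V ^t*)).

Let Qu (x : R) : 0 <= x -> Q x \in unitmx.
Proof. by move=> /Qpos /posdefmx_unit. Qed.

Let Kh (x : R) : 0 <= x -> (K x) ^t* = K x.
Proof. by move=> /Qpos[Qh _]; rewrite /K trmxC_inv Qh. Qed.

Let KD (x : R) : 0 <= x -> mxderive K x (- (2 *: (F x *m (F x) ^t*))).
Proof.
move=> x0; apply: mxderive_eq (mxderive_inv (QD x0) (Qu x0)) _.
rewrite -/(K x) /F trmxC_mul Kh// -scalemxAr -scalemxAl !mulmxA.
by [].
Qed.

(** The equation is linear in [F], and its coefficient [B] is bounded as soon as [K] is. *)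
Let FD (x : R) : 0 <= x -> mxderive F x (B x *m F x).
Proof.
move=> x0; apply: mxderive_eq (mxderiveM (KD x0) (GD x0)) _.
exact: (riccati_linearize (mulVmx (Qu x0)) (mulmxV (Qu x0)) (Kh x0) (AQ x0)).
Qed.

Let phi (x : R) := hsnorm2 (F x).
Let r (x : R) := complex.Re (\tr (K x)).

Let cderive_tr m (M : R -> 'M[R[i]]_m) x D : mxderive M x D ->
  cderive (fun t => \tr (M t)) x (\tr D).
Proof. by move=> MD; apply: cderive_sum => k _; exact: MD. Qed.

Let rD (x : R) : 0 <= x -> is_derive x 1 r (- (2 * phi x)).
Proof.
move=> x0; have [rR _] := cderive_tr (KD x0); apply: is_derive_eq rR _.
by rewrite linearN linearZ /= cReN cRe_natM.
Qed.

(** Since [K = K^H Q K], positivity of [Q] makes the diagonal of [K] nonnegative. *)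
Let r_ge0 x : 0 <= x -> 0 <= r x.
Proof.
move=> x0; rewrite /r /mxtrace cRe_sum sumr_ge0// => k _.
have := posdefmx_diag_ge0 (K x) k (Qpos x0); rewrite Kh// /K mulVmx ?Qu// mul1mx.
by rewrite lecE => /andP[].
Qed.

(** This is the domination hypothesis for the parts of the entries of [K], with [p = r] and constant
    1. *)
Let gram_dominated (x : R) k l : 0 <= x ->
  `|complex.Re ((- (2 *: (F x *m (F x) ^t*))) k l)| <= - (1 * - (2 * phi x)) /\
  `|complex.Im ((- (2 *: (F x *m (F x) ^t*))) k l)| <= - (1 * - (2 * phi x)).
Proof.
move=> x0; have [WR WI] := gram_entry_le (F x) k l.
rewrite !mul1r !opprK mxE [_ k l]mxE cReN cImN !normrN cRe_natM cIm_natM.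
by rewrite !normrM !(@ger0_norm _ 2)// !ler_pM2l.
Qed.

Lemma riccati_inv_cvg : exists L : 'M[R[i]]_n, invmx (Q x) @[x --> +oo] --> L.
Proof.
have /choice[L LP] : forall kl : 'I_n * 'I_n, exists z : R[i], K x kl.1 kl.2 @[x --> +oo] --> z.
  move=> [k l] /=.
  have [a Ka] := derive_dominated_cvg ler01 (fun x x0 => (KD x0 k l).1) rD
    (fun x x0 => (gram_dominated k l x0).1) r_ge0.
  have [b Kb] := derive_dominated_cvg ler01 (fun x x0 => (KD x0 k l).2) rD
    (fun x x0 => (gram_dominated k l x0).2) r_ge0.
  by exists (a +i* b)%C; apply/cvg_complexP.
exists (\matrix_(k, l) L (k, l)); apply/cvg_mxP => k l; rewrite mxE; exact: (LP (k, l)).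
Qed.

Let K_bounded k l : bounded_oy (fun x => K x k l).
Proof.
exists ((`|complex.Re (K 0 k l)| + 1 * r 0) + (`|complex.Im (K 0 k l)| + 1 * r 0)) => x x0.
apply: lerD.
  exact: (derive_dominated_bounded ler01 (fun x x0 => (KD x0 k l).1) rD
    (fun x x0 => (gram_dominated k l x0).1) r_ge0).
exact: (derive_dominated_bounded ler01 (fun x x0 => (KD x0 k l).2) rD
  (fun x x0 => (gram_dominated k l x0).2) r_ge0).
Qed.

Lemma riccati_inv_mul_cvg0 :
  (invmx (Q x) *m G x) @[x --> +oo] --> (0 : 'M[R[i]]_(n, q)).
Proof.
have [b b0 Bb] : exists2 b, 0 <= b & forall x k l, 0 <= x -> norm1c (B x k l) <= b.
  apply: bounded_oy_mx_unif => k l; under eq_fun do rewrite mxE.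
  apply: bounded_oyD; first exact: bounded_oy_cst.
  under eq_fun do rewrite -scaleNr mxE.
  apply: bounded_oyM; first exact: bounded_oy_cst.
  by apply: bounded_oy_mulmx => [|*]; [exact: K_bounded|exact: bounded_oy_cst].
apply: cvg_hsnorm2_0.
pose psi x := \tr (B x *m F x *m (F x) ^t* + F x *m (B x *m F x) ^t*).
have phiD (x : R) : 0 <= x -> is_derive x 1 phi (complex.Re (psi x)).
  by move=> x0; have [] := cderive_tr (mxderiveM (FD x0) (mxderive_adj (FD x0))).
have twophiD (x : R) : 0 <= x -> is_derive x 1 (fun t => 2 * phi t) (2 * complex.Re (psi x)).
  move=> x0; have := phiD x x0 => ?; exact: (@is_deriveZ _ _ _ phi 2).
(* The derivative of [r] is [- (2 phi)], so [derive_dominated_cvg0] applies to [2 phi] rather than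
   to [phi]. *)
suff h : (fun t => 2 * phi t) x @[x --> +oo] --> 0.
  rewrite (_ : (fun x => hsnorm2 _) = fun x => 2^-1 * (2 * phi x)); last first.
    by apply/funext => x; rewrite mulrA mulVf ?mul1r.
  by rewrite -(mulr0 2^-1); exact: cvgMr.
(* The derivative of [phi] is the real part of [tr (B F F^H) + tr (B^H F F^H)]; each term is at most
   [n^2 b phi] in absolute value. *)
apply: (@derive_dominated_cvg0 _ _ _ r (2 * ((n * n)%:R * b)) _ twophiD rD) => [|x x0|x x0|x x0].
- by rewrite mulr_ge0// mulr_ge0.
- rewrite normrM ger0_norm// -mulrA ler_pM2l// /psi mxtraceD cReD.
  rewrite -mulmxA.
  have -> : \tr (F x *m (B x *m F x) ^t*) = \tr ((B x) ^t* *m (F x *m (F x) ^t*)).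
    by rewrite trmxC_mul mulmxA mxtrace_mulC.
  rewrite (le_trans (ler_normD _ _))//.
  have Bt k l : norm1c ((B x ^t*) k l) <= b.
    by rewrite [_ k l]mxE [_ k l]mxE /norm1c cRe_conj cIm_conj normrN; exact: Bb.
  have h1 := trace_gram_le (F x) (fun k l => Bb x k l x0).
  have h2 := trace_gram_le (F x) Bt.
  apply: le_trans (lerD h1 h2) _; rewrite -/(phi x) le_eqVlt; apply/orP; left; apply/eqP.
  by move: (phi x) (_%:R : R) => w N; ring.
- by rewrite mulr_ge0// hsnorm2_ge0.
- exact: r_ge0.
Qed.

End RiccatiAsymptotics.

(** * Limits and adjoints of block matrices *)

Section Blocks.
Context {R : realType} {T : Type} {F : set_system T} {FF : Filter F}.

Lemma cvg_row_mx p q r (f : T -> 'M[R[i]]_(p, q)) (g : T -> 'M[R[i]]_(p, r))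
    (a : 'M[R[i]]_(p, q)) (b : 'M[R[i]]_(p, r)) :
  f x @[x --> F] --> a -> g x @[x --> F] --> b ->
  row_mx (f x) (g x) @[x --> F] --> row_mx a b.
Proof.
move=> /cvg_mxP fa /cvg_mxP gb; apply/cvg_mxP => k l.
by under eq_fun do rewrite mxE; rewrite mxE; case: (fintype.split l) => s; [exact: fa|exact: gb].
Qed.

Lemma cvg_col_mx p q r (f : T -> 'M[R[i]]_(p, r)) (g : T -> 'M[R[i]]_(q, r))
    (a : 'M[R[i]]_(p, r)) (b : 'M[R[i]]_(q, r)) :
  f x @[x --> F] --> a -> g x @[x --> F] --> b ->
  col_mx (f x) (g x) @[x --> F] --> col_mx a b.
Proof.
move=> /cvg_mxP fa /cvg_mxP gb; apply/cvg_mxP => k l.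
by under eq_fun do rewrite mxE; rewrite mxE; case: (fintype.split k) => s; [exact: fa|exact: gb].
Qed.

Lemma trmxC_row_mx p q r (M : 'M[R[i]]_(p, q)) (N : 'M[R[i]]_(p, r)) :
  (row_mx M N) ^t* = col_mx (M ^t*) (N ^t*).
Proof. by rewrite tr_row_mx map_col_mx. Qed.

End Blocks.

(** * Passing from [S] to [Q = E S E^H] *)

Section Gauge.
Context {R : realType} {n m1 m2 : nat}.
Context (A : 'M[R[i]]_n) (th1 : 'M[R[i]]_(n, m1)) (th2 : 'M[R[i]]_(n, m2)).
Context (S : R -> 'M[R[i]]_n).

Lemma expimxM_trmxC p (M : 'M[R[i]]_(n, p)) x : (expimx A x *m M) *m (expimx A x *m M) ^t* =
  expimx A x *m (M *m M ^t*) *m (expimx A x) ^t*.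
Proof. by rewrite trmxC_mul !mulmxA. Qed.

Let U1 x := expimx A (- x) *m th1.
Let U2 x := expimx A x *m th2.
Let Q x := expimx A x *m S x *m (expimx A x) ^t*.

Context (SD : forall x : R, 0 <= x ->
    mxderive S x (U1 x *m (U1 x) ^t* + U2 x *m (U2 x) ^t*))
  (SA : forall x : R, 0 <= x ->
    A *m S x - S x *m A ^t* = 'i *: (U1 x *m (U1 x) ^t* - U2 x *m (U2 x) ^t*))
  (Spos : forall x : R, 0 <= x -> posdefmx (S x)).

Let G x := expimx A x *m (expimx A x *m th2).

Let expimx_unit x : expimx A x \in unitmx.
Proof. by have /mulmx1_unit[] := expimxNx A x. Qed.

Let Qpos (x : R) : 0 <= x -> posdefmx (Q x).
Proof. by move=> x0; apply: posdefmx_congr; [exact: Spos|exact: expimx_unit]. Qed.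

Let U1E x : expimx A x *m (U1 x *m (U1 x) ^t*) *m (expimx A x) ^t* = th1 *m th1 ^t*.
Proof.
rewrite -expimxM_trmxC /U1 mulmxA; have := expimxNx A (- x); rewrite opprK => ->.
by rewrite mul1mx.
Qed.

Let U2E x : expimx A x *m (U2 x *m (U2 x) ^t*) *m (expimx A x) ^t* = G x *m (G x) ^t*.
Proof. by rewrite -expimxM_trmxC. Qed.

(** The identity [SA] is multiplied by [E] on the left and [E^H] on the right; [A] commutes with
    [E], and [E] cancels the exponential in [U1] while doubling the one in [U2]. *)
Let AQ (x : R) : 0 <= x ->
  A *m Q x - Q x *m A ^t* = 'i *: (th1 *m th1 ^t* - G x *m (G x) ^t*).
Proof.
move=> x0; rewrite -(U1E x) -(U2E x) -mulmxBl -mulmxBr scalemxAl scalemxAr -(SA x0).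
rewrite mulmxBr mulmxBl /Q.
have cA : A *m expimx A x = expimx A x *m A by exact: expimx_comm.
have cAt : A ^t* *m (expimx A x) ^t* = (expimx A x) ^t* *m A ^t*.
  by rewrite -!trmxC_mul cA.
by rewrite !mulmxA cA -!(mulmxA _ (A ^t*)) cAt !mulmxA.
Qed.

(** Differentiating the exponentials contributes [i (A Q - Q A^H) = G G^H - th1 th1^H], and
    differentiating [S] contributes [th1 th1^H + G G^H]; the [th1] terms cancel. *)
Let QD (x : R) : 0 <= x -> mxderive Q x (2 *: (G x *m (G x) ^t*)).
Proof.
move=> x0; have ED := mxderive_expimx A x.
apply: mxderive_eq (mxderiveM (mxderiveM ED (SD x0)) (mxderive_adj ED)) _.
have E' : ('i *: (A *m expimx A x)) ^t* = - ('i *: ((expimx A x) ^t* *m A ^t*)).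
  by rewrite linearZ /= map_mxZ /= conjCi scaleNr -trmxC_mul.
rewrite E' mulmxN -scalemxAr -!scalemxAl mulmxDl -!scalemxAl addrAC -scalerBr.
have -> : A *m expimx A x *m S x *m (expimx A x) ^t* -
   expimx A x *m S x *m ((expimx A x) ^t* *m A ^t*) = A *m Q x - Q x *m A ^t*.
  by rewrite /Q !mulmxA.
rewrite AQ// scalerA mulCii scaleN1r mulmxDr mulmxDl U1E U2E.
by rewrite opprB addrA subrK scaler_nat mulr2n.
Qed.

Let GD (x : R) : 0 <= x -> mxderive G x ((2 * 'i) *: (A *m G x)).
Proof.
move=> _; have ED := mxderive_expimx A x.
apply: mxderive_eq (mxderiveM ED (mxderiveMr th2 ED)) _.
rewrite -!scalemxAl -scalemxAr -scalerDr (mulrC 2) -scalerA; congr (_ *: _).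
rewrite scaler_nat mulr2n /G; congr (_ + _); first by rewrite !mulmxA.
by rewrite !mulmxA (@expimx_comm _ _ A A).
Qed.

Lemma gauge_inv_cvg : exists L : 'M[R[i]]_n,
  invmx (expimx A x *m S x *m (expimx A x) ^t*) @[x --> +oo] --> L.
Proof. exact: riccati_inv_cvg QD Qpos. Qed.

Lemma gauge_inv_mul_cvg0 :
  (invmx (expimx A x *m S x *m (expimx A x) ^t*) *m
    (expimx A x *m (expimx A x *m th2))) @[x --> +oo] --> (0 : 'M[R[i]]_(n, m2)).
Proof. exact: riccati_inv_mul_cvg0 QD GD AQ Qpos. Qed.

End Gauge.

(** * The matrices S, Q and R *)

Section Darboux.
Context {R : realType} {n m1 m2 : nat}.
Context (A S0 : 'M[R[i]]_n) (th1 : 'M[R[i]]_(n, m1)) (th2 : 'M[R[i]]_(n, m2)).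

Let U1 x := expimx A (- x) *m th1.
Let U2 x := expimx A x *m th2.
Let W1 x := U1 x *m (U1 x) ^t*.
Let W2 x := U2 x *m (U2 x) ^t*.
Local Notation P := (Pimx A th1 th2).

Lemma Pimx_gram x : P x *m (P x) ^t* = W1 x + W2 x.
Proof. by rewrite /Pimx trmxC_row_mx mul_row_col. Qed.

Let W1D x : mxderive W1 x ('i *: (W1 x *m A ^t* - A *m W1 x)).
Proof.
have U1D : mxderive U1 x (- 'i *: (A *m U1 x)).
  have := mxderiveMr th1 (mxderive_expimx (- A) x).
  rewrite mulNmx scalerN expimxN -scaleNr -scalemxAl -mulmxA => h.
  by apply: mxderive_near h; near=> t; rewrite /U1 expimxN.
apply: mxderive_eq (mxderiveM U1D (mxderive_adj U1D)) _.
have -> : (- 'i *: (A *m U1 x)) ^t* = 'i *: ((U1 x) ^t* *m A ^t*).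
  by rewrite linearZ /= map_mxZ rmorphN /= conjCi opprK -trmxC_mul.
by rewrite -scalemxAl -scalemxAr scaleNr scalerBr addrC /W1 !mulmxA.
Unshelve. all: by end_near. Qed.

Let W2D x : mxderive W2 x ('i *: (A *m W2 x - W2 x *m A ^t*)).
Proof.
have U2D : mxderive U2 x ('i *: (A *m U2 x)).
  have := mxderiveMr th2 (mxderive_expimx A x).
  by rewrite -scalemxAl -mulmxA.
apply: mxderive_eq (mxderiveM U2D (mxderive_adj U2D)) _.
have -> : ('i *: (A *m U2 x)) ^t* = - ('i *: ((U2 x) ^t* *m A ^t*)).
  by rewrite linearZ /= map_mxZ /= conjCi scaleNr -trmxC_mul.
by rewrite -scalemxAl mulmxN -scalemxAr scalerBr /W2 !mulmxA.
Qed.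

(** [Smx] is constantly [S0] on negative reals; integrating from [-1] instead of
    [0] gives a function with a two-sided derivative at [0]. *)
Lemma Smx_extension : exists S : R -> 'M[R[i]]_n,
  [/\ forall x : R, -1 < x -> mxderive S x (W1 x + W2 x), S 0 = S0 &
      forall x : R, 0 <= x -> Smx A S0 th1 th2 x = S x].
Proof.
have [G GD GI] := mx_antiderivative (fun x => mxderiveD (W1D x) (W2D x)).
exists (fun x => S0 + (G x - G 0)); split=> [x x1||x x0].
- apply: mxderive_eq (mxderiveD (mxderive_cst S0 x)
    (mxderiveB (GD x x1) (mxderive_cst (G 0) x))) _.
  by rewrite add0r subr0.
- by rewrite subrr addr0.
- rewrite /Smx -GI//; congr (_ + integralmx _ _ _).
  by apply/funext => t; rewrite Pimx_gram.
Qed.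

Section Extension.
Context (hS0 : posdefmx S0).
Context (hAS : A *m S0 - S0 *m A ^t* =
  'i *: (row_mx th1 th2 *m jmx R m1 m2 *m (row_mx th1 th2) ^t*)).
Context (S : R -> 'M[R[i]]_n).
Context (SD : forall x : R, -1 < x -> mxderive S x (W1 x + W2 x)) (SS0 : S 0 = S0).

Let ltN10 (x : R) : 0 <= x -> -1 < x.
Proof. by apply: lt_le_trans; rewrite ltrN10. Qed.

(** Both sides have the derivative [A (W1 + W2) - (W1 + W2) A^H], so their difference keeps its
    value at 0, which vanishes by [hAS]. *)
Lemma Lyapunov_extension (x : R) : 0 <= x ->
  A *m S x - S x *m A ^t* = 'i *: (W1 x - W2 x).
Proof.
move=> x0; apply/eqP; rewrite -subr_eq0; apply/eqP.
pose D t := A *m S t - S t *m A ^t* - 'i *: (W1 t - W2 t).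
suff : D x = D 0.
  rewrite /D => ->; apply/eqP; rewrite subr_eq0 SS0 hAS; apply/eqP; congr (_ *: _).
  rewrite /jmx mul_row_block !mulmx0 !mulmx1 addr0 add0r mulmxN mulmx1.
  rewrite trmxC_row_mx mul_row_col mulNmx.
  by rewrite /W1 /W2 /U1 /U2 oppr0 !expimx0 !mul1mx.
apply: (@mxderive0_cst_oy _ _ _ D (-1)) => [z z1| |]; rewrite ?ltrN10 ?ltN10//.
apply: mxderive_eq (mxderiveB (mxderiveB (mxderiveMl A (SD z1)) (mxderiveMr (A ^t*) (SD z1)))
  (mxderiveZ 'i (mxderiveB (W1D z) (W2D z)))) _.
rewrite -scalerBr scalerA mulCii scaleN1r opprK mulmxDr mulmxDl.
move: (A *m W1 z) (A *m W2 z) (W1 z *m A ^t*) (W2 z *m A ^t*) => a b c d.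
by apply/matrixP => k l; rewrite !mxE; ring.
Qed.

(** [S] stays Hermitian because its derivative is Hermitian, and [v^H S v] cannot decrease because
    its derivative is the squared norm of [v^H P]. Strict positivity is inherited from [S0]. *)
Lemma posdefmx_extension (x : R) : 0 <= x -> posdefmx (S x).
Proof.
move=> x0; have Wh t : (W1 t + W2 t) ^t* = W1 t + W2 t.
  by rewrite -Pimx_gram trmxC_mul trmxCK.
have Sh : (S x) ^t* = S x.
  apply/eqP; rewrite -subr_eq0; apply/eqP.
  pose D t := (S t) ^t* - S t.
  suff : D x = D 0 by rewrite /D => ->; rewrite SS0 hS0.1 subrr.
  apply: (@mxderive0_cst_oy _ _ _ D (-1)) => [z z1| |]; rewrite ?ltrN10 ?ltN10//.
  apply: mxderive_eq (mxderiveB (mxderive_adj (SD z1)) (SD z1)) _.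
  by rewrite Wh subrr.
split=> // v v0.
pose f t := complex.Re ((v ^t* *m S t *m v) 0 0).
have fD (t : R) : 0 <= t -> is_derive t 1 (fun t => - f t)
    (- complex.Re ((v ^t* *m (W1 t + W2 t) *m v) 0 0)).
  move=> t0; have [fR _] := mxderiveMr v (mxderiveMl (v ^t*) (SD (ltN10 t0))) 0 0.
  exact: is_deriveN fR.
have df0 (t : R) : 0 <= t -> - complex.Re ((v ^t* *m (W1 t + W2 t) *m v) 0 0) <= 0.
  move=> t0; rewrite oppr_le0 -Pimx_gram.
  have := hsnorm2_ge0 (v ^t* *m P t); rewrite /hsnorm2 trace_mx11 trmxC_mul trmxCK.
  by rewrite !mulmxA.
have := derive_le0_nincr fD df0 (lexx 0) x0; rewrite lerN2 /f SS0 => f0x.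
(* Positivity in [R[i]] also demands a zero imaginary part, which comes from [Sh]. *)
rewrite ltcE; apply/andP; split.
  have Im0 (M : 'M[R[i]]_1) : M ^t* = M -> complex.Im (M 0 0) = 0.
    by move=> /(congr1 (fun (N : 'M[R[i]]_1) => complex.Im (N 0 0))); rewrite !mxE cIm_conj; lra.
  by rewrite Im0// !trmxC_mul trmxCK Sh mulmxA.
apply: lt_le_trans f0x.
by have := hS0.2 v v0; rewrite ltcE => /andP[].
Qed.

End Extension.

End Darboux.

(** * Matrix identities behind the factorization of [Y] *)

Section Algebra.
Context {R : realType}.

(** With [N = E^-1], the right-hand side is a right inverse of [S]. Taking [E] to be [e^(ixA)] or
    [e^(-ixA)] expresses [S^-1] through [Q^-1] or [R^-1]. *)
Lemma invmx_congr n (E N S : 'M[R[i]]_n) : N *m E = 1%:M -> S \in unitmx ->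
  invmx S = E ^t* *m invmx (E *m S *m E ^t*) *m E.
Proof.
move=> NE Su; have [Nu Eu] := mulmx1_unit NE.
have Qu : E *m S *m E ^t* \in unitmx.
  by rewrite !unitmx_mul Eu Su map_unitmx unitmx_tr.
set X := RHS; have SX : S *m X = 1%:M.
  have -> : S *m X = N *m ((E *m S *m E ^t*) *m invmx (E *m S *m E ^t*)) *m E.
    by rewrite /X !mulmxA NE mul1mx.
  by rewrite mulmxV// mulmx1.
by rewrite -[LHS]mulmx1 -SX mulmxA mulVmx// mul1mx.
Qed.

Lemma jmx_trmxC m1 m2 : (jmx R m1 m2) ^t* = jmx R m1 m2.
Proof.
rewrite /jmx tr_block_mx map_block_mx !trmx0 !map_mx0 linearN /= map_mxN !trmx1 !map_mx1.
by [].
Qed.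

Lemma jmx_sqr m1 m2 : jmx R m1 m2 *m jmx R m1 m2 = 1%:M.
Proof.
rewrite /jmx mulmx_block !mul0mx !mulmx0 !mulmx1 mulmxN mulNmx mulmx1 opprK.
by rewrite !addr0 add0r -scalar_mx_block.
Qed.

Lemma trmxC_sandwich m n (P : 'M[R[i]]_(n, m)) (B S : 'M[R[i]]_n) : S ^t* = S ->
  (P ^t* *m B ^t* *m S *m P) ^t* = P ^t* *m S *m B *m P.
Proof. by move=> Sh; rewrite 3!trmxC_mul 2!trmxCK Sh !mulmxA. Qed.

(** The adjoint reverses the two factors, and [j^2 = 1] lets [j] travel leftwards across each of
    them. *)
Lemma darboux_factor_trmxC m (j X X0 : 'M[R[i]]_m) : j ^t* = j -> j *m j = 1%:M ->
  ((1%:M - 'i *: (j *m X ^t*)) *m (1%:M + 'i *: (j *m X0))) ^t* *m j =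
  j *m (1%:M - 'i *: (j *m X0 ^t*)) *m (1%:M + 'i *: (j *m X)).
Proof.
move=> jh jj.
have -> : ((1%:M - 'i *: (j *m X ^t*)) *m (1%:M + 'i *: (j *m X0))) ^t* =
    (1%:M - 'i *: (X0 ^t* *m j)) *m (1%:M + 'i *: (X *m j)).
  rewrite trmxC_mul 2!trmxCD trmxCN 2!trmxC_iZ opprK trmxC1 2!trmxC_mul jh.
  by rewrite trmxCK.
have -> : j *m (1%:M - 'i *: (j *m X0 ^t*)) = (1%:M - 'i *: (X0 ^t* *m j)) *m j.
  rewrite mulmxBr mulmxBl mul1mx mulmx1 -scalemxAr -scalemxAl mulmxA jj mul1mx.
  by rewrite -mulmxA jj mulmx1.
rewrite -2!mulmxA; congr (_ *m _).
rewrite mulmxDl mul1mx -scalemxAl -mulmxA jj mulmx1.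
by rewrite mulmxDr mulmx1 -scalemxAr mulmxA jj mul1mx.
Qed.

(** Meant for [B = A^-1], with [S] and [S0] standing for the inverses of [S(x)] and [S(0)]. *)
Lemma darboux_trmxC m n (j : 'M[R[i]]_m) (P P0 : 'M[R[i]]_(n, m)) (B S S0 : 'M[R[i]]_n) :
  j ^t* = j -> j *m j = 1%:M -> S ^t* = S -> S0 ^t* = S0 ->
  ((1%:M - 'i *: (j *m P ^t* *m S *m B *m P)) *m
   (1%:M + 'i *: (j *m P0 ^t* *m B ^t* *m S0 *m P0))) ^t* *m j =
  j *m (1%:M - 'i *: (j *m P0 ^t* *m S0 *m B *m P0)) *m
    (1%:M + 'i *: (j *m P ^t* *m B ^t* *m S *m P)).
Proof.
move=> jh jj Sh S0h.
have assoc (U V : 'M[R[i]]_n) (Z : 'M[R[i]]_(n, m)) :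
    j *m Z ^t* *m U *m V *m Z = j *m (Z ^t* *m U *m V *m Z) by rewrite !mulmxA.
rewrite !assoc -(trmxC_sandwich P B Sh) -(trmxC_sandwich P0 B S0h).
exact: darboux_factor_trmxC.
Qed.

Section GaugeAlgebra.
Context {n m1 m2 : nat} (E N Si Qi Ri B : 'M[R[i]]_n).
Context (th1 : 'M[R[i]]_(n, m1)) (th2 : 'M[R[i]]_(n, m2)).
Context (NE : N *m E = 1%:M) (EN : E *m N = 1%:M).
Context (SQ : Si = E ^t* *m Qi *m E) (SR : Si = N ^t* *m Ri *m N).

Let NtEt p (M : 'M[R[i]]_(n, p)) : N ^t* *m (E ^t* *m M) = M.
Proof. by rewrite mulmxA -trmxC_mul EN trmxC1 mul1mx. Qed.

Let EtNt p (M : 'M[R[i]]_(n, p)) : E ^t* *m (N ^t* *m M) = M.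
Proof. by rewrite mulmxA -trmxC_mul NE trmxC1 mul1mx. Qed.

(** [Si] is expanded by [SQ] in the first block and by [SR] in the second, so that the adjoint
    exponentials cancel in both. *)
Lemma gauge_col_mx :
  (row_mx (N *m th1) (E *m th2)) ^t* *m Si =
  col_mx (th1 ^t* *m Qi *m E) (th2 ^t* *m Ri *m N).
Proof.
rewrite trmxC_row_mx !trmxC_mul mul_col_mx {1}SQ SR -!mulmxA.
by rewrite NtEt EtNt.
Qed.

Context (EB : E ^t* *m B = B *m E ^t*) (NB : N ^t* *m B = B *m N ^t*).

(** [B] commutes with the adjoint exponentials, so they cancel on the left as in [gauge_col_mx]. On
    the right the exponentials cancel in the diagonal blocks and accumulate in the others, producing
    the products that tend to 0. *)
Lemma gauge_block_mx :
  1%:M + 'i *: (jmx R m1 m2 *m (row_mx (N *m th1) (E *m th2)) ^t* *m B *m Si *m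
    row_mx (N *m th1) (E *m th2)) =
  block_mx
    (1%:M + 'i *: (th1 ^t* *m B *m Qi *m th1))
    ('i *: (th1 ^t* *m B *m (Qi *m (E *m (E *m th2)))))
    (- ('i *: (th2 ^t* *m B *m (Ri *m (N *m (N *m th1))))))
    (1%:M - 'i *: (th2 ^t* *m B *m Ri *m th2)).
Proof.
have X1 : th1 ^t* *m N ^t* *m B *m Si = th1 ^t* *m B *m Qi *m E.
  by rewrite SQ -!mulmxA (mulmxA (N ^t*)) NB -mulmxA NtEt.
have X2 : th2 ^t* *m E ^t* *m B *m Si = th2 ^t* *m B *m Ri *m N.
  by rewrite SR -!mulmxA (mulmxA (E ^t*)) EB -mulmxA EtNt.
set W := row_mx (N *m th1) (E *m th2).
have WBS : W ^t* *m B *m Si = col_mx (th1 ^t* *m B *m Qi *m E) (th2 ^t* *m B *m Ri *m N).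
  by rewrite /W trmxC_row_mx !trmxC_mul !mul_col_mx X1 X2.
rewrite -!(mulmxA (jmx R m1 m2)) WBS /W.
rewrite mul_col_row /jmx mulmx_block !mul0mx !mul1mx !mulNmx !mul1mx !addr0 !add0r.
rewrite (scale_block_mx 'i) (scalar_mx_block _ _ 1) add_block_mx !add0r !scalerN.
have -> : th1 ^t* *m B *m Qi *m E *m (N *m th1) = th1 ^t* *m B *m Qi *m th1.
  by rewrite -!mulmxA (mulmxA E) EN mul1mx.
have -> : th2 ^t* *m B *m Ri *m N *m (E *m th2) = th2 ^t* *m B *m Ri *m th2.
  by rewrite -!mulmxA (mulmxA N) NE mul1mx.
have -> : th1 ^t* *m B *m Qi *m E *m (E *m th2) = th1 ^t* *m B *m (Qi *m (E *m (E *m th2))).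
  by rewrite -!mulmxA.
have -> : th2 ^t* *m B *m Ri *m N *m (N *m th1) = th2 ^t* *m B *m (Ri *m (N *m (N *m th1))).
  by rewrite -!mulmxA.
by [].
Qed.

End GaugeAlgebra.

End Algebra.

(** * The limits [kappaQ] and [kappaR], and the limit of the second factor of [u^H j] *)

Section Asymptotics.
Context {R : realType} {n m1 m2 : nat}.
Context (A S0 : 'M[R[i]]_n) (th1 : 'M[R[i]]_(n, m1)) (th2 : 'M[R[i]]_(n, m2)).
Context (hS0 : posdefmx S0).
Context (hAS : A *m S0 - S0 *m A ^t* =
  'i *: (row_mx th1 th2 *m jmx R m1 m2 *m (row_mx th1 th2) ^t*)).

Let E := expimx A.
Let S := Smx A S0 th1 th2.
Let Qi x := invmx (Qmx A S0 th1 th2 x).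
Let Ri x := invmx (Rmx A S0 th1 th2 x).

Lemma Smx_posdef (x : R) : 0 <= x -> posdefmx (S x).
Proof.
have [S' [SD SS0 SE]] := Smx_extension A S0 th1 th2.
by move=> x0; rewrite /S (SE x x0); exact: (posdefmx_extension hS0 SD SS0 x0).
Qed.

(** [kappaQ] is declared by [lim]; exhibiting some limit [L] identifies it. The argument runs on the
    extension [S'], which agrees with [Smx] for [x >= 0], hence near [+oo]. *)
Lemma invmx_Qmx_cvg :
  Qi x @[x --> +oo] --> kappaQ A S0 th1 th2 /\
  (Qi x *m (E x *m (E x *m th2))) @[x --> +oo] --> (0 : 'M[R[i]]_(n, m2)).
Proof.
have [S' [SD SS0 SE]] := Smx_extension A S0 th1 th2.
have SD' (x : R) (x0 : 0 <= x) := SD x (lt_le_trans (ltrN10 R) x0).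
have SA (x : R) (x0 : 0 <= x) := Lyapunov_extension hAS SD SS0 x0.
have Sp (x : R) (x0 : 0 <= x) := posdefmx_extension hS0 SD SS0 x0.
have QE : \forall x \near +oo, invmx (E x *m S' x *m (E x) ^t*) = Qi x.
  by near=> x; rewrite /Qi /Qmx SE// expimx_trmxC.
split.
  have [L hL] := gauge_inv_cvg SD' SA Sp.
  have QL : Qi x @[x --> +oo] --> L.
    by apply: cvg_trans hL; exact: near_eq_cvg.
  by rewrite /kappaQ (cvg_lim _ QL).
apply: cvg_trans (gauge_inv_mul_cvg0 SD' SA Sp); apply: near_eq_cvg.
by apply: filterS QE => x <-.
Unshelve. all: by end_near. Qed.

(** Replacing [(A, th1, th2)] by [(- A, th2, th1)] swaps the two Gram terms: the derivative of [S']
    is unchanged, and both sides of the Lyapunov identity change sign. *)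
Lemma invmx_Rmx_cvg :
  Ri x @[x --> +oo] --> kappaR A S0 th1 th2 /\
  (Ri x *m (E (- x) *m (E (- x) *m th1))) @[x --> +oo] --> (0 : 'M[R[i]]_(n, m1)).
Proof.
have [S' [SD SS0 SE]] := Smx_extension A S0 th1 th2.
have SD' (x : R) : 0 <= x -> mxderive S' x
    ((expimx (- A) (- x) *m th2) *m (expimx (- A) (- x) *m th2) ^t* +
     (expimx (- A) x *m th1) *m (expimx (- A) x *m th1) ^t*).
  by move=> x0; rewrite !expimxN opprK addrC; exact: SD (lt_le_trans (ltrN10 R) x0).
have SA (x : R) : 0 <= x -> (- A) *m S' x - S' x *m (- A) ^t* =
    'i *: ((expimx (- A) (- x) *m th2) *m (expimx (- A) (- x) *m th2) ^t* -
     (expimx (- A) x *m th1) *m (expimx (- A) x *m th1) ^t*).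
  move=> x0; rewrite !expimxN opprK -[in RHS]opprB scalerN -(Lyapunov_extension hAS SD SS0 x0).
  by rewrite trmxCN mulNmx mulmxN opprB opprK addrC.
have Sp (x : R) (x0 : 0 <= x) := posdefmx_extension hS0 SD SS0 x0.
have RE : \forall x \near +oo,
    invmx (expimx (- A) x *m S' x *m (expimx (- A) x) ^t*) = Ri x.
  by near=> x; rewrite /Ri /Rmx SE// expimxN expimx_trmxC opprK.
split.
  have [L hL] := gauge_inv_cvg SD' SA Sp.
  have RL : Ri x @[x --> +oo] --> L.
    by apply: cvg_trans hL; exact: near_eq_cvg.
  by rewrite /kappaR (cvg_lim _ RL).
apply: cvg_trans (gauge_inv_mul_cvg0 SD' SA Sp); apply: near_eq_cvg.
by apply: filterS RE => x <-; rewrite /E expimxN.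
Unshelve. all: by end_near. Qed.

Let N x := E (- x).
Let NE x : N x *m E x = 1%:M.
Proof. exact: expimxNx. Qed.

Let EN x : E x *m N x = 1%:M.
Proof. by have := expimxNx A (- x); rewrite opprK. Qed.

Let Sinv_Q (x : R) : 0 <= x -> invmx (S x) = (E x) ^t* *m Qi x *m E x.
Proof.
move=> x0; have := invmx_congr (NE x) (posdefmx_unit (Smx_posdef x0)).
by rewrite /Qi /Qmx -(expimx_trmxC A x).
Qed.

Let Sinv_R (x : R) : 0 <= x -> invmx (S x) = (N x) ^t* *m Ri x *m N x.
Proof.
move=> x0; have := invmx_congr (EN x) (posdefmx_unit (Smx_posdef x0)).
by rewrite /Ri /Rmx /N (expimx_trmxC A (- x)) opprK.
Qed.

Local Notation B := ((invmx A) ^t*).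

Let EB x : (E x) ^t* *m B = B *m (E x) ^t*.
Proof.
rewrite -!trmxC_mul; congr (_ ^t*); apply: expimx_comm.
have [Au|Au] := boolP (A \in unitmx); first by rewrite mulmxV// mulVmx.
(* On a singular matrix [invmx] is the identity map, so the claim reduces to [A] commuting with
   itself. *)
by rewrite /invmx (negbTE Au).
Qed.

(** The factor [1 + i j Pi^H (A^-1)^H S^-1 Pi] of [u^H j], with [S^-1] expressed
    through [Q^-1] in the first block row and [R^-1] in the second. *)
Definition transfermx x : 'M[R[i]]_(m1 + m2) := block_mx
  (1%:M + 'i *: (th1 ^t* *m B *m Qi x *m th1))
  ('i *: (th1 ^t* *m B *m (Qi x *m (E x *m (E x *m th2)))))
  (- ('i *: (th2 ^t* *m B *m (Ri x *m (E (- x) *m (E (- x) *m th1))))))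
  (1%:M - 'i *: (th2 ^t* *m B *m Ri x *m th2)).

Local Notation j := (jmx R m1 m2).
Local Notation P := (Pimx A th1 th2).

Lemma Pimx_Smx_inv (x : R) : 0 <= x ->
  (P x) ^t* *m invmx (S x) = col_mx (th1 ^t* *m Qi x *m E x) (th2 ^t* *m Ri x *m N x).
Proof. by move=> x0; exact: gauge_col_mx (NE x) (EN x) (Sinv_Q x0) (Sinv_R x0). Qed.

Lemma transfermxE (x : R) : 0 <= x ->
  1%:M + 'i *: (j *m (P x) ^t* *m B *m invmx (S x) *m P x) = transfermx x.
Proof.
move=> x0.
exact: gauge_block_mx (NE x) (EN x) (Sinv_Q x0) (Sinv_R x0) (EB x) (EB (- x)).
Qed.

Lemma transfermx_cvg : transfermx x @[x --> +oo] --> block_mx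
  (1%:M + 'i *: (th1 ^t* *m B *m kappaQ A S0 th1 th2 *m th1)) 0
  0 (1%:M - 'i *: (th2 ^t* *m B *m kappaR A S0 th1 th2 *m th2)).
Proof.
have [Qc Q0] := invmx_Qmx_cvg; have [Rc R0] := invmx_Rmx_cvg.
have z1 : 'i *: (th1 ^t* *m B *m (0 : 'M[R[i]]_(n, m2))) = 0 by rewrite mulmx0 scaler0.
have z2 : - ('i *: (th2 ^t* *m B *m (0 : 'M[R[i]]_(n, m1)))) = 0 by rewrite mulmx0 scaler0 oppr0.
(* The zero blocks are written as images of the zero limits [Q0] and [R0], so that each block limit
   follows from continuity. *)
set a := 1%:M + _; set d := 1%:M - _; rewrite (_ : block_mx a 0 0 d = block_mx a
  ('i *: (th1 ^t* *m B *m (0 : 'M[R[i]]_(n, m2))))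
  (- ('i *: (th2 ^t* *m B *m (0 : 'M[R[i]]_(n, m1))))) d);
  last by rewrite z1 z2.
apply: cvg_col_mx; apply: cvg_row_mx.
- apply: cvgD; [exact: cvg_cst|apply: cvgZr; apply: cvg_mulmx; [|exact: cvg_cst]].
  apply: cvg_mulmx; [exact: cvg_cst|exact: Qc].
- apply: cvgZr; apply: cvg_mulmx; [exact: cvg_cst|exact: Q0].
- apply: cvgN; apply: cvgZr; apply: cvg_mulmx; [exact: cvg_cst|exact: R0].
- apply: cvgB; [exact: cvg_cst|apply: cvgZr; apply: cvg_mulmx; [|exact: cvg_cst]].
  apply: cvg_mulmx; [exact: cvg_cst|exact: Rc].
Qed.

Lemma umx_trmxC (x : R) : 0 <= x ->
  (umx A S0 th1 th2 x) ^t* *m j = j *m wA A S0 th1 th2 0 0 *m transfermx x.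
Proof.
move=> x0; rewrite -(transfermxE x0) /wA /umx.
have -> : A - (0 : R[i])%:M = A by rewrite raddf0 subr0.
have Sh (y : R) (y0 : 0 <= y) : (invmx (Smx A S0 th1 th2 y)) ^t* = invmx (Smx A S0 th1 th2 y).
  by rewrite trmxC_inv (Smx_posdef y0).1.
exact: darboux_trmxC (jmx_trmxC _ _) (jmx_sqr _ _) (Sh x x0) (Sh 0 (lexx 0)).
Qed.

End Asymptotics.

(** * Assembling the asymptotics of [Y] *)

Unset Implicit Arguments.

Theorem theorem3p4 (R : realType) (n m1 m2 : nat)
    (A S0 : 'M[R[i]]_n)
    (th1 : 'M[R[i]]_(n, m1)) (th2 : 'M[R[i]]_(n, m2))
    (hm1 : (0 < m1)%N) (hm2 : (0 < m2)%N)
    (hS0 : posdefmx S0) (hA : \det A != 0)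
    (hAS : A *m S0 - S0 *m A ^t* =
           'i *: (row_mx th1 th2 *m jmx R m1 m2 *m (row_mx th1 th2) ^t*)) :
  let kQ := kappaQ A S0 th1 th2 in
  let kR := kappaR A S0 th1 th2 in
  exists (o0 : R -> 'M[R[i]]_(m1 + m2))
         (o1 : R -> 'M[R[i]]_(m1, n)) (o2 : R -> 'M[R[i]]_(m2, n)),
    [/\ o0 x @[x --> +oo] --> (0 : 'M[R[i]]_(m1 + m2)),
        o1 x @[x --> +oo] --> (0 : 'M[R[i]]_(m1, n)),
        o2 x @[x --> +oo] --> (0 : 'M[R[i]]_(m2, n)) &
        forall x t : R, 0 <= x ->
          Ymx A S0 th1 th2 x t =
          (jmx R m1 m2 *m wA A S0 th1 th2 0 0
             *m block_mx
                  (1%:M + 'i *: (th1 ^t* *m (invmx A) ^t* *m kQ *m th1)) 0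
                  0 (1%:M - 'i *: (th2 ^t* *m (invmx A) ^t* *m kR *m th2))
           + o0 x)
          *m col_mx ((th1 ^t* *m kQ + o1 x) *m expimx A (t + x))
                    ((th2 ^t* *m kR + o2 x) *m expimx A (t - x))].
Proof.
move=> kQ kR.
have [Qc _] := invmx_Qmx_cvg hS0 hAS.
have [Rc _] := invmx_Rmx_cvg hS0 hAS.
have Tc := transfermx_cvg hS0 hAS.
set D := block_mx _ _ _ _ in Tc.
(* Each remainder is the exact difference between a factor and its limit, so the formula is an
   identity at every [x >= 0]. *)
exists (fun x => jmx R m1 m2 *m wA A S0 th1 th2 0 0 *m (transfermx A S0 th1 th2 x - D)),
  (fun x => th1 ^t* *m (invmx (Qmx A S0 th1 th2 x) - kQ)),
  (fun x => th2 ^t* *m (invmx (Rmx A S0 th1 th2 x) - kR)); split.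
- rewrite -(mulmx0 _ (jmx R m1 m2 *m wA A S0 th1 th2 0 0)) -(subrr D).
  apply: cvg_mulmx; [exact: cvg_cst|apply: cvgB; [exact: Tc|exact: cvg_cst]].
- rewrite -(mulmx0 _ (th1 ^t*)) -(subrr kQ).
  apply: cvg_mulmx; [exact: cvg_cst|apply: cvgB; [exact: Qc|exact: cvg_cst]].
- rewrite -(mulmx0 _ (th2 ^t*)) -(subrr kR).
  apply: cvg_mulmx; [exact: cvg_cst|apply: cvgB; [exact: Rc|exact: cvg_cst]].
move=> x t x0.
have -> : Ymx A S0 th1 th2 x t = (umx A S0 th1 th2 x) ^t* *m jmx R m1 m2 *m
    ((Pimx A th1 th2 x) ^t* *m invmx (Smx A S0 th1 th2 x)) *m expimx A t.
  by rewrite /Ymx !mulmxA.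
rewrite (Pimx_Smx_inv A th1 th2 hS0 x0) (umx_trmxC A th1 th2 hS0 x0).
have dist p q r (M : 'M[R[i]]_(p, q)) (X Y : 'M[R[i]]_(q, r)) :
  M *m X + M *m (Y - X) = M *m Y by rewrite -mulmxDr addrC subrK.
rewrite (dist _ _ _ (jmx R m1 m2 *m _) D) (dist _ _ _ _ kQ) (dist _ _ _ _ kR).
(* The sums are commuted so that [expimxD] yields [e^(ixA)] or [e^(-ixA)] to the left of [e^(itA)],
   the order found in [Y]. *)
rewrite -mulmxA mul_col_mx (addrC t x) (addrC t (- x)) (expimxD A x t) (expimxD A (- x) t).
by rewrite !(mulmxA _ (expimx A _) (expimx A _)).
Qed.
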